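(* Let $E$ be a unital $C^*$-algebra, let $\mathcal B$ be a closed (two-sided) ideal of $E$, and let $\mathcal A=E/\mathcal B$. Suppose that $\mathcal A$ is a unital simple purely infinite $C^*$-algebra, that $\mathcal B$ is an essential ideal of $E$, and that $\mathcal B$ is separable and simple with $\mathrm{RR}(\mathcal B)=0$ and property (PC). Then $$K_0(E)=\{[p] : p \text{ is a projection in } E\setminus\mathcal B\},$$ that is, the map sending the Murray–von Neumann equivalence class $[p]$ of a projection $p\in E\setminus\mathcal B$ to the class of $p$ in $K_0(E)$ is a bijection from $\{[p] : p \text{ is a projection in } E\setminus\mathcal B\}$ onto $K_0(E)$.
   Context: Two projections $p,q$ in a $C^*$-algebra $\mathcal E$ are equivalent, $p\sim q$, if $p=v^*v$ and $q=vv^*$ for some $v\in\mathcal E$; $[p]$ denotes the equivalence class of $p$ under $\sim$. For projections $p,r\in\mathcal E$, $[p]\le[r]$ (resp. $[p]<[r]$) means that there is a projection $q\le r$ (resp. $q\le r$, $q\ne r$) with $p\sim q$. A projection $p$ is infinite if $[p]<[p]$. A simple $C^*$-algebra is purely infinite if every nonzero hereditary $C^*$-subalgebra of it contains an infinite projection. $\mathrm{RR}(\mathcal E)=0$ (real rank zero) means that every self-adjoint element of $\mathcal E$ can be approximated in norm by self-adjoint elements of $\mathcal E$ with finite spectrum. Property (PC): a non-unital, $\sigma$-unital $C^*$-algebra $\mathcal E$ with $\mathrm{RR}(\mathcal E)=0$ has property (PC) if it has finitely many (densely defined) traces, say $\tau_1,\dots,\tau_k$, such that (1) there is an approximate unit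 $\{e_n\}$ of $\mathcal E$ consisting of projections with $\lim_{n\to\infty}\tau_i(e_n)=\infty$ for $i=1,\dots,k$; and (2) for any two projections $p,q\in\mathcal E$, if $\tau_i(p)<\tau_i(q)$ for all $i=1,\dots,k$, then $[p]\le[q]$. *)

(* Defs.v *)
From HB Require Import structures.
From mathcomp Require Import all_boot all_order all_algebra generic_quotient.
From mathcomp Require Import all_classical all_reals all_analysis.
From mathcomp Require Import complex.

Set Implicit Arguments.
Unset Strict Implicit.
Unset Printing Implicit Defensive.

Import Order.TTheory GRing.Theory Num.Theory.
Import numFieldNormedType.Exports.

Local Open Scope classical_set_scope.
Local Open Scope ring_scope.
Local Open Scope quotient_scope.

Reserved Notation "x ** y" (at level 40, left associativity).

(* Unital C*-algebras. The norm of a normed module over [R[i]] takes its values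
   in the nonnegative reals of [R[i]]. The library has no common substructure of
   rings and normed modules other than numeric domains, so the product is part of
   the structure; the ring structure is carried by the alias [cring] below. *)
HB.mixin Record isCStarAlgebra (R : realType) E
    of CompleteNormedModule R[i] E := {
  cmul : E -> E -> E;
  cone : E;
  star : E -> E;
  cmulA : forall x y z : E, cmul x (cmul y z) = cmul (cmul x y) z;
  cmul1x : forall x : E, cmul cone x = x;
  cmulx1 : forall x : E, cmul x cone = x;
  cmulDl : forall x y z : E, cmul (x + y) z = cmul x z + cmul y z;
  cmulDr : forall x y z : E, cmul x (y + z) = cmul x y + cmul x z;
  cmulZl : forall (a : R[i]) (x y : E), cmul (a *: x) y = a *: cmul x y;
  cmulZr : forall (a : R[i]) (x y : E), cmul x (a *: y) = a *: cmul x y;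
  starD : forall x y : E, star (x + y) = star x + star y;
  starZ : forall (a : R[i]) (x : E), star (a *: x) = conjc a *: star x;
  starM : forall x y : E, star (cmul x y) = cmul (star y) (star x);
  starK : forall x : E, star (star x) = x;
  cstar_normM : forall x y : E, `|cmul x y| <= `|x| * `|y|;
  cstar_identity : forall x : E, `|cmul (star x) x| = `|x| ^+ 2
}.

#[short(type="cstarAlgType")]
HB.structure Definition CStarAlgebra (R : realType) :=
  {E of isCStarAlgebra R E & CompleteNormedModule R[i] E}.

Notation "x ** y" := (cmul x y) : ring_scope.

(* A not necessarily unital C*-algebra is represented as a C*-subalgebra
   [D : set E] of a unital C*-algebra [E]; the unital C*-algebra [E] itself is
   [setT]. All the notions below are those of the C*-algebra [D]. *)
Section CStar.
Context {R : realType} {E : cstarAlgType R}.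
Implicit Types (D B H J : set E) (p q r x y : E).

Definition subspace_set D :=
  [/\ D 0, (forall x y, D x -> D y -> D (x + y))
    & forall (a : R[i]) x, D x -> D (a *: x)].

Definition sub_cstar D :=
  [/\ closed D, subspace_set D, (forall x y, D x -> D y -> D (x ** y))
    & forall x, D x -> D (star x)].

Definition closed_ideal D J :=
  [/\ J `<=` D, closed J, subspace_set J
    & forall x y, D x -> J y -> J (x ** y) /\ J (y ** x)].

Definition simple_cstar D :=
  D <> [set 0] /\ forall J, closed_ideal D J -> J = [set 0] \/ J = D.

Definition essential_ideal B :=
  forall J, closed_ideal setT J -> J <> [set 0] -> B `&` J <> [set 0].

Definition separable_set D :=
  exists S : set E, [/\ countable S, S `<=` D & D `<=` closure S].

Definition has_unit D :=
  exists2 u, D u & forall x, D x -> u ** x = x /\ x ** u = x.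

Definition positive_in D x := exists2 y, D y & x = star y ** y.

Definition le_in D x y := positive_in D (y - x).

Definition projection p := star p = p /\ p ** p = p.

Definition mvn_equiv D p q :=
  exists2 v, D v & p = star v ** v /\ q = v ** star v.

Definition mvn_le D p r :=
  exists q, [/\ D q, projection q, le_in D q r & mvn_equiv D p q].

Definition mvn_lt D p r :=
  exists q, [/\ D q, projection q, le_in D q r, q <> r & mvn_equiv D p q].

Definition infinite_projection D p := [/\ D p, projection p & mvn_lt D p p].

Definition hereditary D H :=
  [/\ sub_cstar H, H `<=` D
    & forall x y, positive_in D x -> H y -> le_in D x y -> H x].

Definition purely_infinite D :=
  simple_cstar D /\
  forall H, hereditary D H -> H <> [set 0] ->
    exists2 p, H p & infinite_projection D p.

(* Invertibility is tested in [D + C 1], which is the unitization of [D] if [D]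
   has no unit, and [D] itself if [D] contains the unit of [E]. If [D] has a unit
   other than that of [E], this only adds the point 0 to the spectrum. *)
Definition spectrum D x : set R[i] :=
  [set z | ~ exists d (a : R[i]), let y := d + a *: cone in
     [/\ D d, y ** (x - z *: cone) = cone & (x - z *: cone) ** y = cone]].

Definition real_rank_zero D :=
  forall x, D x -> star x = x -> forall eps : R[i], 0 < eps ->
    exists y, [/\ D y, star y = y, finite_set (spectrum D y) & `|x - y| < eps].

Definition approximate_unit D (e : nat -> E) :=
  (forall n, [/\ D (e n), positive_in D (e n) & `|e n| <= 1]) /\
  forall x, D x ->
    (fun n => e n ** x) @ \oo --> x /\ (fun n => x ** e n) @ \oo --> x.

Definition sigma_unital D := exists e, approximate_unit D e.

(* A trace is a [0, +oo]-valued function on the positive cone of [D]; its values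
   elsewhere are irrelevant. *)
Definition densely_defined_trace D (tau : E -> \bar R) :=
  [/\ forall x, positive_in D x -> (0 <= tau x)%E,
      forall x y, positive_in D x -> positive_in D y ->
        tau (x + y) = (tau x + tau y)%E,
      forall (t : R) x, 0 <= t -> positive_in D x ->
        tau ((real_complex R t) *: x) = (t%:E * tau x)%E,
      forall x, D x -> tau (star x ** x) = tau (x ** star x)
    & positive_in D `<=` closure [set x | positive_in D x /\ (tau x < +oo)%E]].

Definition property_PC D :=
  [/\ ~ has_unit D, sigma_unital D, real_rank_zero D
    & exists k (tau : 'I_k -> E -> \bar R),
      [/\ forall i, densely_defined_trace D (tau i),
          exists e : nat -> E,
            [/\ approximate_unit D e, forall n, projection (e n)
              & forall i, (fun n => tau i (e n)) @ \oo --> +oo%E]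
        & forall p q, D p -> projection p -> D q -> projection q ->
            (forall i, (tau i p < tau i q)%E) -> mvn_le D p q]].

Definition mvn_class p : set E :=
  [set q | projection q /\ mvn_equiv setT p q].

End CStar.

Definition star_morphism (R : realType) (E A : cstarAlgType R)
    (pi : {linear E -> A}) :=
  (forall x y, pi (x ** y) = pi x ** pi y) /\
  (forall x, pi (star x) = star (pi x)).

(* [pi] exhibits the C*-algebra [A] as the quotient [E / B], with the quotient
   norm |x + B| = inf_(b in B) |x + b|. *)
Definition is_quotient (R : realType) (E A : cstarAlgType R) (B : set E)
    (pi : {linear E -> A}) :=
  [/\ star_morphism pi,
      forall y, exists x, pi x = y,
      forall x, pi x = 0 <-> B x,
      forall x b, B b -> `|pi x| <= `|x + b|
    & forall x (eps : R[i]), 0 < eps ->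
        exists2 b, B b & `|x + b| < `|pi x| + eps].

Section Grothendieck.
Variable M : nmodType.
Implicit Types x y z : M * M.

(* [(a, b)] stands for the formal difference [a - b]. *)
Definition groth_rel x y : bool :=
  `[< exists c, x.1 + y.2 + c = y.1 + x.2 + c >].

Lemma groth_rel_refl : reflexive groth_rel.
Proof. by move=> x; apply/asboolP; exists 0. Qed.

Lemma groth_rel_sym : symmetric groth_rel.
Proof. by move=> x y; apply/asboolP/asboolP => -[c h]; exists c; rewrite h. Qed.

Lemma groth_rel_trans : transitive groth_rel.
Proof.
move=> y x z /asboolP[c h] /asboolP[d k]; apply/asboolP.
exists (y.1 + y.2 + c + d).
transitivity ((x.1 + y.2 + c) + (y.1 + z.2 + d)).
  by rewrite [LHS](AC (2*4) ((1*4*5)*(3*2*6)))/=.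
by rewrite h k [LHS](AC (3*3) ((4*2)*(1*5*3*6)))/=.
Qed.

Canonical groth_equiv :=
  EquivRel groth_rel groth_rel_refl groth_rel_sym groth_rel_trans.

Definition groth := {eq_quot groth_equiv}.
HB.instance Definition _ := Choice.on groth.

Definition groth_class x : groth := \pi_{eq_quot groth_equiv} x.
Definition groth_add (u v : groth) : groth := groth_class (repr u + repr v).
Definition groth_opp (u : groth) : groth :=
  groth_class ((repr u).2, (repr u).1).

Lemma groth_classP x y : reflect (exists c, x.1 + y.2 + c = y.1 + x.2 + c)
  (groth_class x == groth_class y).
Proof. by rewrite /groth_class eqmodE; exact: asboolP. Qed.

Lemma groth_class_repr x :
  exists c, (repr (groth_class x)).1 + x.2 + c = x.1 + (repr (groth_class x)).2 + c.
Proof. by apply/groth_classP; rewrite /groth_class reprK. Qed.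

Lemma groth_ind (P : groth -> Prop) : (forall x, P (groth_class x)) -> forall u, P u.
Proof. by move=> h u; rewrite -[u]reprK; exact: h. Qed.

Lemma groth_class_add x y :
  groth_add (groth_class x) (groth_class y) = groth_class (x + y).
Proof.
apply/eqP/groth_classP.
have [c h] := groth_class_repr x; have [d k] := groth_class_repr y.
move: h k; set x' := repr _; set y' := repr _ => h k; exists (c + d) => /=.
transitivity ((x'.1 + x.2 + c) + (y'.1 + y.2 + d)).
  by rewrite [LHS](AC ((2*2)*2) ((1*3*5)*(2*4*6)))/=.
by rewrite h k [LHS](AC (3*3) ((1*4)*(2*5)*(3*6)))/=.
Qed.

Lemma groth_class_opp x : groth_opp (groth_class x) = groth_class (x.2, x.1).
Proof.
apply/eqP/groth_classP; have [c h] := groth_class_repr x; exists c => /=.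
by rewrite [x.2 + _]addrC h [x.1 + _]addrC.
Qed.

Lemma groth_addA : associative groth_add.
Proof.
elim/groth_ind => x; elim/groth_ind => y; elim/groth_ind => z.
by rewrite !groth_class_add addrA.
Qed.

Lemma groth_addC : commutative groth_add.
Proof.
by elim/groth_ind => x; elim/groth_ind => y; rewrite !groth_class_add addrC.
Qed.

Lemma groth_add0 : left_id (groth_class 0) groth_add.
Proof. by elim/groth_ind => x; rewrite groth_class_add add0r. Qed.

Lemma groth_addN : left_inverse (groth_class 0) groth_opp groth_add.
Proof.
elim/groth_ind => x; rewrite groth_class_opp groth_class_add.
by apply/eqP/groth_classP; exists 0 => /=; rewrite !addr0 add0r addrC.
Qed.

HB.instance Definition _ :=
  GRing.isZmodule.Build groth groth_addA groth_addC groth_add0 groth_addN.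

End Grothendieck.

Definition cring (R : realType) (E : cstarAlgType R) : Type := E.

Section Cring.
Context {R : realType} {E : cstarAlgType R}.
HB.instance Definition _ := GRing.Zmodule.copy (cring E) E.
HB.instance Definition _ := GRing.Zmodule_isPzRing.Build (cring E)
  (@cmulA R E) (@cmul1x R E) (@cmulx1 R E) (@cmulDl R E) (@cmulDr R E).
End Cring.

Section K0.
Context {R : realType} {E : cstarAlgType R}.

Definition adjmx m n (A : 'M[cring E]_(m, n)) : 'M[cring E]_(n, m) :=
  \matrix_(i, j) (star (A j i : E) : cring E).

Lemma star0 : star (0 : E) = 0.
Proof. by apply: (addrI (star 0)); rewrite -starD !addr0. Qed.

Lemma adjmxK m n (A : 'M[cring E]_(m, n)) : adjmx (adjmx A) = A.
Proof. by apply/matrixP => i j; rewrite !mxE starK. Qed.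

Lemma adjmx0 m n : adjmx (0 : 'M[cring E]_(m, n)) = 0.
Proof. by apply/matrixP => i j; rewrite !mxE; exact: star0. Qed.

Lemma adjmxM m n k (A : 'M[cring E]_(m, n)) (B : 'M[cring E]_(n, k)) :
  adjmx (A *m B) = adjmx B *m adjmx A.
Proof.
apply/matrixP => i j; rewrite !mxE.
rewrite (big_morph (star : cring E -> cring E) (@starD R E) star0).
by apply: eq_bigr => l _; rewrite !mxE; exact: starM.
Qed.

Lemma adjmx_row m n k (A : 'M[cring E]_(m, n)) (B : 'M[cring E]_(m, k)) :
  adjmx (row_mx A B) = col_mx (adjmx A) (adjmx B).
Proof. by apply/matrixP => i j; rewrite !mxE; case: (fintype.split _) => l; rewrite !mxE. Qed.

Lemma adjmx_col m n k (A : 'M[cring E]_(m, n)) (B : 'M[cring E]_(k, n)) :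
  adjmx (col_mx A B) = row_mx (adjmx A) (adjmx B).
Proof. by apply/matrixP => i j; rewrite !mxE; case: (fintype.split _) => l; rewrite !mxE. Qed.

Lemma adjmx_block m n k l (A : 'M[cring E]_(m, k)) B C (D : 'M[cring E]_(n, l)) :
  adjmx (block_mx A B C D) =
  block_mx (adjmx A) (adjmx C) (adjmx B) (adjmx D).
Proof. by rewrite /block_mx adjmx_col !adjmx_row -block_mxEh. Qed.

Definition projection_mx n (p : 'M[cring E]_n) : bool :=
  (adjmx p == p) && (p *m p == p).

Definition projmx := {P : {n & 'M[cring E]_n} | projection_mx (tagged P)}.
HB.instance Definition _ := Choice.on projmx.

Definition pm_size (P : projmx) : nat := tag (val P).
Definition pm_mx (P : projmx) : 'M[cring E]_(pm_size P) := tagged (val P).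

Definition Projmx n (p : 'M[cring E]_n) (hp : projection_mx p) : projmx :=
  exist _ (Tagged (fun n => 'M[cring E]_n) p) hp.

Definition mvn_mx_rel (P Q : projmx) : bool :=
  `[< exists v : 'M[cring E]_(pm_size Q, pm_size P),
        pm_mx P = adjmx v *m v /\ pm_mx Q = v *m adjmx v >].

Lemma pm_adj P : adjmx (pm_mx P) = pm_mx P.
Proof. by case: P => -[n p] /= hp; have /andP[/eqP] := hp. Qed.

Lemma pm_idem P : pm_mx P *m pm_mx P = pm_mx P.
Proof. by case: P => -[n p] /= hp; have /andP[_ /eqP] := hp. Qed.

Lemma mvn_mx_refl : reflexive mvn_mx_rel.
Proof. by move=> P; apply/asboolP; exists (pm_mx P); rewrite pm_adj pm_idem. Qed.

Lemma mvn_mx_symm P Q : mvn_mx_rel P Q -> mvn_mx_rel Q P.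
Proof.
by move=> /asboolP[v [h k]]; apply/asboolP; exists (adjmx v); rewrite adjmxK.
Qed.

Lemma mvn_mx_sym : symmetric mvn_mx_rel.
Proof. by move=> P Q; apply/idP/idP => /mvn_mx_symm. Qed.

Lemma mvn_mx_trans : transitive mvn_mx_rel.
Proof.
move=> Q P S /asboolP[v [hP hQ]] /asboolP[w [kQ kS]]; apply/asboolP.
exists (w *m v); rewrite adjmxM; split.
  by rewrite mulmxA -(mulmxA _ (adjmx w)) -kQ hQ mulmxA -hP -mulmxA -hP pm_idem.
by rewrite mulmxA -(mulmxA w) -hQ kQ mulmxA -kS -mulmxA -kS pm_idem.
Qed.

Canonical mvn_mx_equiv :=
  EquivRel mvn_mx_rel mvn_mx_refl mvn_mx_sym mvn_mx_trans.

Definition mvn_semigroup := {eq_quot mvn_mx_equiv}.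
HB.instance Definition _ := Choice.on mvn_semigroup.

Definition V_class (P : projmx) : mvn_semigroup := \pi_{eq_quot mvn_mx_equiv} P.

Lemma V_classP P Q : reflect (exists v : 'M[cring E]_(pm_size Q, pm_size P),
    pm_mx P = adjmx v *m v /\ pm_mx Q = v *m adjmx v) (V_class P == V_class Q).
Proof. by rewrite /V_class eqmodE; exact: asboolP. Qed.

Lemma V_class_repr P : mvn_mx_rel P (repr (V_class P)).
Proof. by rewrite mvn_mx_sym -[X in is_true X]eqmodE reprK. Qed.

Lemma V_ind (T : mvn_semigroup -> Prop) :
  (forall P, T (V_class P)) -> forall a, T a.
Proof. by move=> h a; rewrite -[a]reprK; exact: h. Qed.

Lemma dsum_proj (P Q : projmx) :
  projection_mx (block_mx (pm_mx P) 0 0 (pm_mx Q)).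
Proof.
rewrite /projection_mx adjmx_block !adjmx0 !pm_adj eqxx /=.
by rewrite mulmx_block !mul0mx !mulmx0 !addr0 !add0r !pm_idem.
Qed.

Definition dsum (P Q : projmx) : projmx := Projmx (dsum_proj P Q).

Lemma proj0_proj : projection_mx (0 : 'M[cring E]_0).
Proof. by rewrite /projection_mx adjmx0 mul0mx eqxx. Qed.

Definition proj0 : projmx := Projmx proj0_proj.

Definition V_add (a b : mvn_semigroup) : mvn_semigroup :=
  V_class (dsum (repr a) (repr b)).

Lemma V_class_add P Q : V_add (V_class P) (V_class Q) = V_class (dsum P Q).
Proof.
apply/esym/eqP/V_classP.
have /asboolP[v [h k]] := V_class_repr P.
have /asboolP[w [h' k']] := V_class_repr Q.
exists (block_mx v 0 0 w); rewrite adjmx_block !adjmx0 !mulmx_block.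
by rewrite !mul0mx !mulmx0 !addr0 !add0r -h -h' -k -k'.
Qed.

Lemma V_addC : commutative V_add.
Proof.
elim/V_ind => P; elim/V_ind => Q; rewrite !V_class_add; apply/eqP/V_classP.
exists (block_mx 0 (pm_mx Q) (pm_mx P) 0).
rewrite adjmx_block !adjmx0 !mulmx_block !pm_adj.
by rewrite !mul0mx !mulmx0 !addr0 !add0r !pm_idem.
Qed.

Lemma V_add0 : left_id (V_class proj0) V_add.
Proof.
elim/V_ind => P; rewrite V_class_add; apply/eqP/V_classP.
exists (row_mx 0 (pm_mx P)).
rewrite adjmx_row adjmx0 mul_col_row mul_row_col pm_adj.
by rewrite !mul0mx !mulmx0 !add0r pm_idem.
Qed.

Lemma V_addA : associative V_add.
Proof.
elim/V_ind => P; elim/V_ind => Q; elim/V_ind => S.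
rewrite !V_class_add; apply/eqP/V_classP.
exists (block_mx (col_mx (pm_mx P) 0) (block_mx 0 0 (pm_mx Q) 0)
                 (0 : 'M[cring E]_(pm_size S, pm_size P)) (row_mx 0 (pm_mx S))).
rewrite !(adjmx_block, adjmx_row, adjmx_col, adjmx0) !mulmx_block !pm_adj.
rewrite !(mul_row_col, mul_col_row, mulmx_block, mul0mx, mulmx0, addr0, add0r).
rewrite !(row_mx0, mulmx0, mul_block_col, mul0mx, add_block_mx, addr0, add0r).
by rewrite !(col_mx0, pm_idem).
Qed.

HB.instance Definition _ :=
  GRing.isNmodule.Build mvn_semigroup V_addA V_addC V_add0.

Definition K0 : zmodType := groth mvn_semigroup.

Lemma projection_mx1 (p : E) : projection p ->
  projection_mx (const_mx (p : cring E) : 'M[cring E]_1).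
Proof.
move=> [h k]; apply/andP; split; apply/eqP/matrixP => i j; rewrite !mxE //.
by rewrite big_ord1 !mxE.
Qed.

Definition K0_class (p : E) (hp : projection p) : K0 :=
  groth_class (V_class (Projmx (projection_mx1 hp)), 0).

End K0.
Arguments K0 {R} E.

(* Main.v *)
(* Every projection [q] outside [B] dominates [V V*] for an isometry [V] with
   [q - V V*] still outside [B]. Indeed pure infiniteness of [A] gives an isometry
   [w] with [w w* < pi q]; its lift, cut down by [1 - e_n] for a projection [e_n] of
   the approximate unit of [B], is close to a partial isometry with support
   [1 - e_n] and range under [q]. The missing [e_n] is embedded in the remaining
   projection [r] of [q] by comparison with a projection [s] in [B] of larger trace:
   since [1 = a r a* + b] with [b] in [B], any [s = e_k - (range of e_k e_m)] with
   [e_m b] close to [b] is orthogonal to [e_m] and subequivalent to [r], and its traces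
   tend to infinity with [k].
   Hence [E] contains orthogonal isometries, so every matrix projection is equivalent
   to a projection of [E], and the classes of the projections outside [B] form an ideal
   of the Murray-von Neumann semigroup in which [a + c = b] is always solvable. Such an
   ideal is a group, and it coincides with the Grothendieck group (Cuntz). *)

Require Import Defs.
From mathcomp Require Import all_boot all_order all_algebra.
From mathcomp Require Import all_classical all_reals all_analysis.
From mathcomp Require Import complex ring lra.
From Stdlib Require Ncring Ncring_tac.

Set Implicit Arguments.
Unset Strict Implicit.
Unset Printing Implicit Defensive.

Import Order.TTheory GRing.Theory Num.Theory.
Import numFieldNormedType.Exports.

Local Open Scope classical_set_scope.
Local Open Scope ring_scope.
Local Open Scope complex_scope.

(** * Norm, square roots and inverses *)

Section CStarRing.
Context {R : realType} {E : cstarAlgType R}.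
Implicit Types (x y z : E).

Lemma cmul0x x : 0 ** x = 0.
Proof. by apply: (addrI (0 ** x)); rewrite -cmulDl !addr0. Qed.

Lemma cmulx0 x : x ** 0 = 0.
Proof. by apply: (addrI (x ** 0)); rewrite -cmulDr !addr0. Qed.

Definition csub (x y : E) : E := x - y.

(** Presents [E] to [ncring], which then settles noncommutative polynomial identities; stars and
    scalar multiples are atoms for it. *)
#[global] Instance cstar_ring_ops :
  @Ncring.Ring_ops E 0 (cone : E) +%R cmul csub -%R eq := {}.

#[global] Instance cstar_ring : Ncring.Ring (Ro := cstar_ring_ops).
Proof.
split.
- exact: RelationClasses.eq_equivalence.
- by move=> ? ? -> ? ? ->.
- by move=> ? ? -> ? ? ->.
- by move=> ? ? -> ? ? ->.
- by move=> ? ? ->.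
- exact: add0r.
- exact: addrC.
- exact: addrA.
- exact: cmul1x.
- exact: cmulx1.
- exact: cmulA.
- exact: cmulDl.
- by move=> x y z; exact: cmulDr.
- by [].
- exact: subrr.
Qed.
End CStarRing.

Ltac ncring := Ncring_tac.non_commutative_ring.

Section CStarNorm.
Context {R : realType} {E : cstarAlgType R}.
Implicit Types (x y z : E) (s t : R).

Lemma cmulBl x y z : (x - y) ** z = x ** z - y ** z.
Proof. ncring. Qed.

Lemma cmulBr x y z : x ** (y - z) = x ** y - x ** z.
Proof. ncring. Qed.

Lemma cmulNx x y : - x ** y = - (x ** y).
Proof. ncring. Qed.

Lemma starN x : star (- x) = - star x.
Proof. by apply: (addrI (star x)); rewrite -starD !subrr star0. Qed.

Lemma starB x y : star (x - y) = star x - star y.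
Proof. by rewrite starD starN. Qed.

Lemma star1 : star (cone : E) = cone.
Proof. by rewrite -[LHS]cmulx1 -{2}[cone]starK -starM cmulx1 starK. Qed.

Lemma starZr t x : star (t%:C *: x) = t%:C *: star x.
Proof. by rewrite starZ conjc_real. Qed.

(** The norm takes real values inside [R[i]]; its real part carries it to [R], where [lra] and [nra]
    apply. *)
Definition rn x : R := complex.Re `|x|.

Lemma rnE x : `|x| = (rn x)%:C.
Proof. by rewrite /rn RRe_real // normr_real. Qed.

Lemma rn_ge0 x : 0 <= rn x.
Proof. by rewrite -ler0c -rnE normr_ge0. Qed.

Lemma rnD x y : rn (x + y) <= rn x + rn y.
Proof. by rewrite -lecR rmorphD /= -!rnE ler_normD. Qed.

Lemma rnN x : rn (- x) = rn x.
Proof. by rewrite /rn normrN. Qed.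

Lemma rnB x y : rn (x - y) <= rn x + rn y.
Proof. by rewrite -(rnN y) rnD. Qed.

Lemma rnBC x y : rn (x - y) = rn (y - x).
Proof. by rewrite -rnN opprB. Qed.

Lemma rn0 : rn (0 : E) = 0.
Proof. by rewrite /rn normr0. Qed.

Lemma rn_eq0 x : rn x = 0 -> x = 0.
Proof. by move=> h; apply/eqP; rewrite -normr_eq0 rnE h. Qed.

Lemma rnM x y : rn (x ** y) <= rn x * rn y.
Proof. by rewrite -lecR rmorphM /= -!rnE cstar_normM. Qed.

Lemma rnZ t x : rn (t%:C *: x) = `|t| * rn x.
Proof.
apply: complexI; rewrite -rnE normrZ rmorphM /= -rnE; congr (_ * _).
by rewrite normc_def /= expr0n /= addr0 sqrtr_sqr.
Qed.

Lemma rn_cstar x : rn (star x ** x) = rn x ^+ 2.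
Proof. by apply: complexI; rewrite rmorphXn /= -!rnE cstar_identity. Qed.

Lemma rn_star x : rn (star x) = rn x.
Proof.
suff h y : rn y <= rn (star y) by apply/eqP; rewrite eq_le h -{2}(starK x) h.
have := rnM (star y) y; rewrite rn_cstar expr2.
have := rn_ge0 y; rewrite le_eqVlt => /predU1P[<- _|y0]; first exact: rn_ge0.
by rewrite ler_pM2r.
Qed.

(** [rn cone] equals its own square. It may be 0, since the zero algebra is allowed. *)
Lemma rn_1 : rn (cone : E) <= 1.
Proof.
have := rn_cstar (cone : E); rewrite star1 cmulx1.
by have := rn_ge0 (cone : E); nra.
Qed.

Lemma cstar_eq0 x : star x ** x = 0 -> x = 0.
Proof.
move=> h; apply: rn_eq0; have := rn_cstar x; rewrite h rn0 => /esym/eqP.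
by rewrite sqrf_eq0 => /eqP.
Qed.

Lemma rn_small x : (forall e, 0 < e -> rn x <= e) -> x = 0.
Proof.
move=> h; apply: rn_eq0; apply/eqP; rewrite eq_le rn_ge0 andbT.
by apply/ler_addgt0Pl => e e0; rewrite addr0 h.
Qed.

(** * Sequential limits in the norm *)

Definition tends (u : nat -> E) (l : E) :=
  forall e : R, 0 < e -> exists N, forall n, (N <= n)%N -> rn (u n - l) < e.

Lemma cvg_tends (u : nat -> E) l : u @ \oo --> l -> tends u l.
Proof.
move=> /cvgrPdist_lt h e e0.
have [N _ hN] := h e%:C (ltac:(by rewrite ltcR)).
by exists N => n /hN; rewrite /= rnE ltcR rnBC.
Qed.

(** Majorant principle: [t] is nondecreasing and bounded, and its increments control those of [u],
    so [u] is Cauchy. In the uses below [t] follows the recursion of [u], run on scalars. *)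
Lemma dominated_cvg (u : nat -> E) (t : nat -> R) (M : R) :
  (forall n, rn (u n.+1 - u n) <= t n.+1 - t n) -> (forall n, t n <= M) ->
  exists l, tends u l.
Proof.
move=> ut tM.
have umn n k : rn (u (n + k)%N - u n) <= t (n + k)%N - t n.
  elim: k => [|k ih]; first by rewrite addn0 !subrr rn0.
  rewrite addnS (_ : _ - u n = (u (n + k).+1 - u (n + k)%N) + (u (n + k)%N - u n)).
    by have := rnD (u (n + k).+1 - u (n + k)%N) (u (n + k)%N - u n); have := ut (n + k)%N; lra.
  by rewrite addrA subrK.
pose S := range t.
have Ssup : has_sup S.
  by split; [exists (t 0%N), 0%N | exists M => _ [n _ <-]].
suff : cauchy (u @ \oo).
  move=> /(@cauchy_cvgP E) h; exists (lim (u @ \oo)); exact: cvg_tends.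
apply: (@cauchy_exP R[i] E) => e e0.
have e0' : 0 < complex.Re e by move: e0; rewrite ltcE => /andP[].
have [_ [N _ <-] hN] := sup_adherent e0' Ssup.
exists (u N), N => // n /= Nn.
rewrite -ball_normE /= rnE.
have -> : e = (complex.Re e)%:C by rewrite RRe_real // ger0_real // ltW.
rewrite ltcR rnBC -(subnKC Nn).
apply: le_lt_trans (umn _ _) _.
have : t (N + (n - N))%N <= sup S by apply: ub_le_sup; [case: Ssup|exists (N + (n - N))%N].
by move: hN; lra.
Qed.

Lemma tends_unique u l l' : tends u l -> tends u l' -> l = l'.
Proof.
move=> hl hl'; apply/eqP; rewrite -subr_eq0; apply/eqP/rn_small => e e0.
have e2 : 0 < e / 2 by lra.
have [N hN] := hl _ e2; have [M hM] := hl' _ e2.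
have := hN (maxn N M) (leq_maxl _ _); have := hM (maxn N M) (leq_maxr _ _).
set v := u _; rewrite (rnBC v l) => h1 h2.
have -> : l - l' = (l - v) + (v - l') by rewrite addrA subrK.
by apply: le_trans (rnD _ _) _; lra.
Qed.

Lemma tends_cst l : tends (fun=> l) l.
Proof. by move=> e e0; exists 0%N => n _; rewrite subrr rn0. Qed.

Lemma tends_shift u l : tends u l -> tends (fun n => u n.+1) l.
Proof. by move=> h e /h[N hN]; exists N => n Nn; apply: hN; exact: leqW. Qed.

Lemma tendsD u v l m : tends u l -> tends v m -> tends (fun n => u n + v n) (l + m).
Proof.
move=> hl hm e e0; have e2 : 0 < e / 2 by lra.
have [N hN] := hl _ e2; have [M hM] := hm _ e2; exists (maxn N M) => n.
rewrite geq_max => /andP[/hN h1 /hM h2]; rewrite opprD addrACA.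
by apply: le_lt_trans (rnD _ _) _; lra.
Qed.

Lemma tends_lip (f : E -> E) (K : R) : (forall x y, rn (f x - f y) <= K * rn (x - y)) ->
  forall u l, tends u l -> tends (fun n => f (u n)) (f l).
Proof.
move=> fK u l h e e0.
have K1 : 0 < `|K| + 1 by have := normr_ge0 K; lra.
have [N hN] := h (e / (`|K| + 1)) (divr_gt0 e0 K1).
exists N => n /hN; rewrite ltr_pdivlMr // => hn.
apply: le_lt_trans (fK _ _) _; have := ler_norm K; have := rn_ge0 (u n - l); nra.
Qed.

Lemma tendsMl x u l : tends u l -> tends (fun n => x ** u n) (x ** l).
Proof. by apply: (@tends_lip (cmul x) (rn x)) => y z; rewrite -cmulBr rnM. Qed.

Lemma tendsMr x u l : tends u l -> tends (fun n => u n ** x) (l ** x).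
Proof. by apply: (@tends_lip (fun y => y ** x) (rn x)) => y z; rewrite -cmulBl mulrC rnM. Qed.

Lemma tendsZ t u l : tends u l -> tends (fun n => t%:C *: u n) (t%:C *: l).
Proof. by apply: (@tends_lip (fun y => t%:C *: y) `|t|) => y z; rewrite -scalerBr rnZ. Qed.

Lemma tends_star u l : tends u l -> tends (fun n => star (u n)) (star l).
Proof. by apply: (@tends_lip star 1) => y z; rewrite -starB rn_star mul1r. Qed.

Lemma tends_le u l M : tends u l -> (forall n, rn (u n) <= M) -> rn l <= M.
Proof.
move=> hl hM; apply/ler_addgt0Pl => e /hl[N /(_ N (leqnn N)) hN].
have -> : l = u N - (u N - l) by rewrite opprB addrC subrK.
by apply: le_trans (rnB _ _) _; have := hM N; lra.
Qed.

Lemma tends_sqr u l M : tends u l -> (forall n, rn (u n) <= M) ->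
  tends (fun n => u n ** u n) (l ** l).
Proof.
move=> hl hM e e0; have lM := tends_le hl hM.
have M1 : 0 < 2 * M + 1 by have := rn_ge0 l; lra.
have [N hN] := hl (e / (2 * M + 1)) (divr_gt0 e0 M1).
exists N => n /hN; rewrite ltr_pdivlMr // => hn.
have -> : u n ** u n - l ** l = u n ** (u n - l) + (u n - l) ** l by ncring.
apply: le_lt_trans (rnD _ _) _.
have := rnM (u n) (u n - l); have := rnM (u n - l) l.
have := rn_ge0 (u n - l); have := hM n; nra.
Qed.

(** The iterates of [w -> 1 + d w] are the partial sums of the Neumann series, and the limit is a
    fixed point. *)
Lemma right_neumann d : rn d < 1 -> exists w, (cone - d) ** w = cone.
Proof.
move=> d1; pose u := fun n => iter n (fun w => cone + d ** w) 0.
pose t := fun n => iter n (fun s => 1 + rn d * s) 0.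
have d0 := rn_ge0 d.
have tM n : 0 <= t n <= (1 - rn d)^-1.
  elim: n => [|n /andP[h1 h2]] /=; first by rewrite lexx invr_ge0; lra.
  have e : (1 - rn d) * (1 - rn d)^-1 = 1 by rewrite mulfV //; lra.
  by apply/andP; split; move: h1 h2 e; set q := (1 - rn d)^-1; nra.
have [] := @dominated_cvg u t ((1 - rn d)^-1).
- elim=> [|n ih] /=.
    by rewrite cmulx0 mulr0 !subr0 !addr0 rn_1.
  have -> : cone + d ** u n.+1 - (cone + d ** u n) = d ** (u n.+1 - u n) by ncring.
  by apply: le_trans (rnM _ _) _; move: ih; rewrite /=; nra.
- by move=> n; case/andP: (tM n).
move=> w hw; exists w.
have : w = cone + d ** w.
  apply: tends_unique (tends_shift hw) _.
  exact: tendsD (tends_cst _) (tendsMl _ hw).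
by move=> e; rewrite cmulBl cmul1x {1}e addrK.
Qed.

(** A right inverse for [star d] becomes a left inverse for [d] by taking adjoints, and a left and a
    right inverse coincide. *)
Lemma neumann d : rn d < 1 ->
  exists w, (cone - d) ** w = cone /\ w ** (cone - d) = cone.
Proof.
move=> d1; have [w hw] := right_neumann d1.
have [v hv] := @right_neumann (star d) (ltac:(by rewrite rn_star)).
exists w; split=> //.
have h : star v ** (cone - d) = cone.
  by rewrite -[LHS]starK starM starK starB star1 hv star1.
by rewrite (_ : w = star v) // -[star v]cmulx1 -hw cmulA h cmul1x.
Qed.

Lemma scal_half x : (2^-1)%:C *: x + (2^-1)%:C *: x = x.
Proof.
by rewrite -scalerDl -rmorphD /= (_ : _ + _ = 1) ?scale1r //; lra.
Qed.

(** With [d = 1 - x], the iteration [z -> (d + z z) / 2] has a limit with [2 z = d + z z], that is,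
    [(1 - z)^2 = x]. The scalar majorant [s -> (1 + s^2) / 2] stays in [0, 1]. The iterates are real
    polynomials in [d], hence self-adjoint and commuting with whatever commutes with [x]. *)
Lemma sqrt_exists x : star x = x -> rn (cone - x) <= 1 ->
  exists y, [/\ star y = y, y ** y = x, rn (cone - y) <= 1
    & forall w, w ** x = x ** w -> w ** y = y ** w].
Proof.
set d := cone - x => sx d1.
have sd : star d = d by rewrite starB star1 sx.
pose u := fun n => iter n (fun z => (2^-1)%:C *: (d + z ** z)) 0.
pose t : nat -> R := fun n => iter n (fun s => (1 + s ^+ 2) / 2) 0.
have t01 n : 0 <= t n <= 1.
  by elim: n => [|n /andP[h1 h2]] /=; rewrite ?lexx ?ler01 //; apply/andP; split; nra.
have ut n : rn (u n) <= t n.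
  elim: n => [|n ih]; first by rewrite rn0.
  rewrite /= rnZ ger0_norm ?invr_ge0 //.
  have := rnD d (u n ** u n); have := rnM (u n) (u n); have := rn_ge0 (u n).
  by move: ih; rewrite -/(u n) -/(t n); case/andP: (t01 n); nra.
have [] := @dominated_cvg u t 1.
- elim=> [|n ih].
    by rewrite /= cmulx0 addr0 !subr0 rnZ ger0_norm ?invr_ge0 //; lra.
  (* A difference of squares without commutation; the same factorization of [t n.+2 - t n.+1] keeps
     the increments dominated. *)
  rewrite (_ : u n.+2 - u n.+1 = (2^-1)%:C *: ((u n.+1 - u n) ** u n.+1 + u n ** (u n.+1 - u n))).
    rewrite rnZ ger0_norm ?invr_ge0 //.
    set D := u n.+1 - u n in ih *.
    have := rnD (D ** u n.+1) (u n ** D); have := rnM D (u n.+1); have := rnM (u n) D.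
    have -> : t n.+2 = (1 + t n.+1 ^+ 2) / 2 by [].
    have e : t n.+1 = (1 + t n ^+ 2) / 2 by [].
    have h1 := ut n.+1; have h2 := ut n; have h3 := rn_ge0 D.
    have /andP[h4 _] := t01 n; have /andP[h5 _] := t01 n.+1.
    have h6 := rn_ge0 (u n); have h7 := rn_ge0 (u n.+1).
    have : rn D * rn (u n.+1) <= (t n.+1 - t n) * t n.+1 by apply: ler_pM.
    have : rn (u n) * rn D <= t n * (t n.+1 - t n) by apply: ler_pM.
    by rewrite {3}e; nra.
  have -> : u n.+2 = (2^-1)%:C *: (d + u n.+1 ** u n.+1) by [].
  have -> : u n.+1 = (2^-1)%:C *: (d + u n ** u n) by [].
  rewrite -scalerBr; congr (_ *: _); ncring.
- by move=> n; case/andP: (t01 n).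
move=> z hz.
have u1 n : rn (u n) <= 1 by apply: le_trans (ut n) _; case/andP: (t01 n).
have e : z = (2^-1)%:C *: (d + z ** z).
  apply: tends_unique (tends_shift hz) _.
  exact: tendsZ (tendsD (tends_cst _) (tends_sqr hz u1)).
have e2 : z + z = d + z ** z by rewrite {1 2}e scal_half.
exists (cone - z); split.
- rewrite starB star1; congr (_ - _); apply: (tends_unique _ hz).
  have su n : star (u n) = u n.
    by elim: n => [|n ih]; rewrite /= ?star0 // starZr starD starM -/(u n) ih sd.
  by have := @tends_star u z hz; rewrite (_ : (fun n => star (u n)) = u) //; apply/funext.
- have -> : (cone - z) ** (cone - z) = cone - (z + z) + z ** z by ncring.
  by rewrite e2 /d; ncring.
- by rewrite opprB addrC subrK (tends_le hz u1).
- move=> w wx; have wu n : w ** u n = u n ** w.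
    elim: n => [|n ih]; first by rewrite cmulx0 cmul0x.
    rewrite [u n.+1]/= cmulZl cmulZr -/(u n) cmulDl cmulDr; congr (_ *: (_ + _)).
      by rewrite /d cmulBl cmulBr wx cmul1x cmulx1.
    by rewrite cmulA ih -cmulA ih cmulA.
  rewrite cmulBr cmulBl cmul1x cmulx1; congr (_ - _).
  apply: (tends_unique (tendsMl w hz)).
  by have := tendsMr w hz; rewrite (_ : (fun n => u n ** w) = (fun n => w ** u n)) //; apply/funext => n.
Qed.

End CStarNorm.

(** * Positivity *)

Section Positive.
Context {R : realType} {E : cstarAlgType R}.
Implicit Types (x y z : E) (s t : R).

Lemma conjc_i : ('i%C : R[i])^* = - 'i%C.
Proof. by apply/eqP; rewrite eq_complex /= oppr0 !eqxx. Qed.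

(** Real scalars as central elements of [E], so that they take part in the products that [ncring]
    handles. *)
Definition sc t : E := t%:C *: cone.

Lemma scE t x : sc t ** x = t%:C *: x.
Proof. by rewrite cmulZl cmul1x. Qed.

Lemma scC t x : sc t ** x = x ** sc t.
Proof. by rewrite scE cmulZr cmulx1. Qed.

Lemma sc1 : sc 1 = cone.
Proof. by rewrite /sc scale1r. Qed.

Lemma scD s t : sc (s + t) = sc s + sc t.
Proof. by rewrite /sc rmorphD scalerDl. Qed.

Lemma scM s t : sc (s * t) = sc s ** sc t.
Proof. by rewrite scE /sc scalerA rmorphM. Qed.

Lemma star_sc t : star (sc t) = sc t.
Proof. by rewrite starZr star1. Qed.

Lemma rn_sc t : rn (sc t) <= `|t|.
Proof. by rewrite rnZ ler_piMr // rn_1. Qed.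

Lemma rn_scM t x : rn (sc t ** x) = `|t| * rn x.
Proof. by rewrite scE rnZ. Qed.

Lemma rn_scMp t x : 0 < t -> rn (sc t ** x) = t * rn x.
Proof. by move=> t0; rewrite rn_scM gtr0_norm. Qed.

Lemma rn_sqr x : star x = x -> rn (x ** x) = rn x ^+ 2.
Proof. by move=> h; rewrite -{1}h rn_cstar. Qed.

(** With [u = x + i y], commutation gives [star u ** u = x x + y y]; and [x] is the mean of [u] and
    [star u], so its norm is at most that of [u]. *)
Lemma rn_comm_sqr x y : star x = x -> star y = y -> x ** y = y ** x ->
  rn x ^+ 2 <= rn (x ** x + y ** y).
Proof.
move=> sx sy xy; pose u := x + 'i%C *: y; pose v := x - 'i%C *: y.
have su : star u = v by rewrite starD starZ sx sy conjc_i scaleNr.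
have -> : x ** x + y ** y = star u ** u.
  rewrite su (_ : v ** u = x ** x + (x ** ('i%C *: y) - ('i%C *: y) ** x)
    - ('i%C *: y) ** ('i%C *: y)); last by rewrite /u /v; ncring.
  by rewrite !cmulZl !cmulZr scalerA -expr2 sqr_i scaleN1r opprK xy subrr addr0.
rewrite rn_cstar.
have {1}-> : x = sc 2^-1 ** (u + star u).
  by rewrite su /u /v addrACA subrr addr0 scE scalerDr scal_half.
rewrite rn_scM ger0_norm ?invr_ge0 //.
have := rnD u (star u); rewrite rn_star => h.
rewrite lerXn2r ?nnegrE ?mulr_ge0 ?invr_ge0 ?rn_ge0 //; lra.
Qed.

(* [|t - x| <= t] for some [t > 0] says that the spectrum is nonnegative, without
   mentioning the spectrum. *)
Definition pos x := star x = x /\ exists2 t : R, 0 < t & rn (sc t - x) <= t.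

(** Division by [t] brings [x] within distance 1 of the unit, where [sqrt_exists] applies; the root
    is scaled back by the square root of [t]. *)
Lemma pos_sqrt x : pos x -> exists y, [/\ star y = y, y ** y = x, pos y
    & forall w, w ** x = x ** w -> w ** y = y ** w].
Proof.
move=> [sx [t t0 ht]].
have t0' : t != 0 by rewrite gt_eqF.
have [] := @sqrt_exists _ _ (sc t^-1 ** x).
- by rewrite starM sx star_sc scC.
- rewrite (_ : cone - _ = sc t^-1 ** (sc t - x)); last first.
    by rewrite cmulBr -scM mulVf // sc1.
  rewrite rn_scMp ?invr_gt0 //.
  by rewrite mulrC ler_pdivrMr // mul1r.
move=> y [sy yy y1 yc]; exists (sc (Num.sqrt t) ** y).
have sy' : star (sc (Num.sqrt t) ** y) = sc (Num.sqrt t) ** y.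
  by rewrite starM sy star_sc scC.
have s0 : 0 < Num.sqrt t by rewrite sqrtr_gt0.
split=> //.
- rewrite cmulA -[_ ** y ** sc _]cmulA -scC !cmulA -scM -cmulA yy cmulA -scM.
  by rewrite -expr2 sqr_sqrtr ?mulfV ?sc1 ?cmul1x // ltW.
- split=> //; exists (Num.sqrt t) => //.
  rewrite (_ : sc _ - _ = sc (Num.sqrt t) ** (cone - y)); last by ncring.
  by rewrite rn_scMp // ler_piMr // ltW.
- move=> w wx; rewrite cmulA -scC -cmulA yc ?cmulA //.
  by rewrite -scC -cmulA wx cmulA.
Qed.

(** For [t > 0] let [q] be [a] divided by the square root of [t]. Then [1 - q q] has a square root
    [b] commuting with [q], and [b b + q q = 1] bounds [b] by [rn_comm_sqr]. *)
Lemma sqr_bound a t : star a = a -> 0 <= t -> rn (a ** a) <= t ->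
  rn (sc t - a ** a) <= t.
Proof.
move=> sa t0 at_; move: t0; rewrite le_eqVlt => /predU1P[t0|t0].
  have -> : a ** a = 0 by apply: rn_eq0; apply/eqP; rewrite eq_le rn_ge0 andbT; lra.
  by rewrite -t0 subr0 (le_trans (rn_sc 0)) // normr0.
have t0' : t != 0 by rewrite gt_eqF.
pose q := sc (Num.sqrt t)^-1 ** a.
have sq : star q = q by rewrite starM sa star_sc -scC.
have qq : q ** q = sc t^-1 ** (a ** a).
  rewrite /q cmulA -[_ ** a ** sc _]cmulA -scC !cmulA -scM.
  by rewrite -invfM -expr2 sqr_sqrtr // ltW.
have [] := @sqrt_exists _ _ (cone - q ** q).
- by rewrite starB star1 starM sq.
- rewrite opprB addrC subrK qq rn_scM ger0_norm ?invr_ge0; last lra.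
  by rewrite mulrC ler_pdivrMr // mul1r.
move=> b [sb bb _ bc].
have bq : b ** q = q ** b by apply/esym/bc; ncring.
have := rn_comm_sqr sb sq bq; rewrite bb subrK => hb.
rewrite (_ : sc t - _ = sc t ** (cone - q ** q)); last first.
  by rewrite cmulBr cmulx1 qq cmulA -scM mulfV // sc1 cmul1x.
rewrite rn_scMp // -bb rn_sqr // ler_piMr; [by []|exact: ltW|].
exact: le_trans hb rn_1.
Qed.

Lemma pos_sqr a : star a = a -> pos (a ** a).
Proof.
move=> sa; split; first by rewrite starM sa.
have h := rn_ge0 (a ** a).
by exists (rn (a ** a) + 1); [lra|apply: sqr_bound => //; lra].
Qed.

Lemma pos_bound x t : pos x -> rn x <= t -> rn (sc t - x) <= t.
Proof.
move=> /pos_sqrt[y [sy <- _ _]] h; apply: sqr_bound => //.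
exact: le_trans (rn_ge0 _) h.
Qed.

Lemma posD x y : pos x -> pos y -> pos (x + y).
Proof.
move=> [sx [t t0 ht]] [sy [s s0 hs]]; split; first by rewrite starD sx sy.
exists (t + s); first by lra.
rewrite scD opprD addrACA; apply: le_trans (rnD _ _) _; lra.
Qed.

Lemma posZ t x : 0 <= t -> pos x -> pos (sc t ** x).
Proof.
move=> t0 /pos_sqrt[y [sy <- _ _]].
rewrite (_ : _ ** _ = (sc (Num.sqrt t) ** y) ** (sc (Num.sqrt t) ** y)).
  by apply: pos_sqr; rewrite starM star_sc sy scC.
by rewrite -cmulA [y ** (_ ** _)]cmulA -scC !cmulA -scM -expr2 sqr_sqrtr.
Qed.

Lemma pos_compl x t : pos x -> rn x <= t -> pos (sc t - x).
Proof.
move=> [sx _] h; split; first by rewrite starB star_sc sx.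
have := rn_ge0 x => h0; exists (t + 1); first by lra.
rewrite scD sc1 [X in rn X](_ : _ = cone + x); last by ncring.
by have := rnD cone x; have := @rn_1 R E; lra.
Qed.

(** The square roots [m] of [x] and [r] of [t - x] commute and satisfy [m m + r r = t], so
    [rn_comm_sqr] bounds [m]. *)
Lemma pos_le_sc x t : 0 <= t -> pos x -> pos (sc t - x) -> rn x <= t.
Proof.
move=> t0 /pos_sqrt[m [sm mm _ mc]] /pos_sqrt[r [sr rr _ rc]].
have xr : x ** r = r ** x.
  by apply: rc; rewrite cmulBl cmulBr scC.
have := rn_comm_sqr sm sr (esym (mc r (esym xr))).
rewrite mm rr -mm -rn_sqr // addrC subrK => h.
by apply: le_trans h _; apply: le_trans (rn_sc _) _; rewrite ger0_norm.
Qed.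

Lemma pos_mono x y : pos x -> pos y -> rn x <= rn (x + y).
Proof.
move=> px py; apply: pos_le_sc => //; first exact: rn_ge0.
rewrite [X in pos X](_ : _ = (sc (rn (x + y)) - (x + y)) + y); last by ncring.
by apply: posD => //; apply: pos_compl => //; exact: posD.
Qed.

Lemma pos_anti x : pos x -> pos (- x) -> x = 0.
Proof.
move=> px nx; apply: rn_eq0; apply/eqP; rewrite eq_le rn_ge0 andbT.
by have := pos_mono px nx; rewrite subrr rn0.
Qed.

(* With [X = y* y <= 0], [Y = y y* >= 0] and [c = |y|^2], the intertwining relation
   [(c + Y)^2 y = y (c + X)^2] gives [2 c |Y|^2 <= |(c + Y)^2 Y| <= c^3]. *)
Lemma pos_opp_star y : pos (- (star y ** y)) -> y = 0.
Proof.
set X := star y ** y; set Y := y ** star y => nX.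
have pY : pos Y.
  (* Here [p p + q q = 2 (X + Y)], so [2 Y] is a sum of two squares and [- 2 X], all positive. *)
  pose p := y + star y; pose q := 'i%C *: (y - star y).
  have sp : star p = p by rewrite starD starK addrC.
  have sq : star q = q.
    by rewrite starZ starB starK conjc_i scaleNr -scalerN opprB.
  have qq : q ** q = - ((y - star y) ** (y - star y)).
    by rewrite cmulZl cmulZr scalerA -expr2 sqr_i scaleN1r.
  rewrite (_ : Y = sc 2^-1 ** ((p ** p + q ** q) + (- X - X))).
    by apply: posZ; [rewrite invr_ge0|apply: posD; apply: posD => //; exact: pos_sqr].
  rewrite qq (_ : _ + _ = Y + Y); last by rewrite /p /X /Y; ncring.
  by rewrite scE scalerDr scal_half.
set c := rn y ^+ 2.
have cX : rn X = c by rewrite rn_cstar.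
have cY : rn Y = c by rewrite /Y -{1}[y]starK rn_cstar rn_star.
have c0 : 0 <= c by rewrite exprn_ge0 // rn_ge0.
have hX : rn (sc c + X) <= c.
  by rewrite -[X]opprK; apply: pos_bound => //; rewrite rnN cX.
have sY : star Y = Y by case: pY.
have : rn (sc (2 * c) ** (Y ** Y)) <= c ^+ 3.
  (* These are the other terms in the expansion of [(c + Y)^2 Y]; being positive, they can only
     increase the norm. *)
  apply: le_trans (@pos_mono _ (sc (c * c) ** Y + Y ** Y ** Y) _ _) _.
  - by apply: posZ; [lra|exact: pos_sqr].
  - apply: posD; first by apply: posZ => //; nra.
    have [m [sm mm _ _]] := pos_sqrt pY.
    rewrite (_ : _ ** _ ** _ = (m ** m ** m) ** (m ** m ** m)).
      by apply: pos_sqr; rewrite !starM sm cmulA.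
    by rewrite -mm; ncring.
  have -> : sc (2 * c) ** (Y ** Y) + (sc (c * c) ** Y + Y ** Y ** Y) =
      (sc c + Y) ** (sc c + Y) ** Y.
    rewrite scM scM (_ : sc 2 = cone + cone); last first.
      by rewrite -{1}[2]/(1 + 1) scD sc1.
    have e := scC c Y.
    have -> : (sc c + Y) ** (sc c + Y) ** Y =
       (sc c ** sc c ** Y + sc c ** Y ** Y + (Y ** sc c) ** Y + Y ** Y ** Y) by ncring.
    by rewrite -e; ncring.
  have -> : (sc c + Y) ** (sc c + Y) ** Y = y ** (sc c + X) ** ((sc c + X) ** star y).
    have e : (sc c + Y) ** y = y ** (sc c + X).
      by rewrite cmulDl cmulDr scC /X /Y cmulA.
    by rewrite {3}/Y cmulA -[_ ** _ ** y]cmulA e cmulA e !cmulA.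
  apply: le_trans (rnM _ _) _.
  have := rnM y (sc c + X); have := rnM (sc c + X) (star y); rewrite rn_star.
  have := rn_ge0 y; have := rn_ge0 (y ** (sc c + X)); have := rn_ge0 ((sc c + X) ** star y).
  set u := rn (_ ** star y); set v := rn (y ** _) => u0 v0 y0 hu hv.
  have hu' : u <= c * rn y by nra.
  have hv' : v <= rn y * c by nra.
  by apply: le_trans (ler_pM v0 u0 hv' hu') _; rewrite /c; lra.
have -> : rn (sc (2 * c) ** (Y ** Y)) = 2 * c * c ^+ 2.
  by rewrite rn_scM rn_sqr // cY ger0_norm // mulr_ge0.
move=> h.
have : c ^+ 3 <= 0 by nra.
move=> hc; have : c ^+ 3 == 0 by rewrite eq_le hc exprn_ge0.
rewrite expf_eq0 /=.
by rewrite /c sqrf_eq0 => /eqP/rn_eq0.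
Qed.

(* For [a = x* x] and [b = |a|], the element [y = x (b - a)] has [- y* y >= 0]. *)
Lemma pos_star x : pos (star x ** x).
Proof.
set a := star x ** x.
have sa : star a = a by rewrite starM starK.
have [b [sb bb pb bc]] := pos_sqrt (pos_sqr sa).
have ab : a ** b = b ** a by apply: bc; ncring.
have [c [sc cc _ Cc]] := pos_sqrt pb.
(* Since [b] is the absolute value of [a], [m] is twice the negative part of [a]; the aim is
   [m = 0]. *)
pose m := b - a.
have sm : star m = m by rewrite starB sa sb.
have mab : m ** a = - (m ** b).
  apply/eqP; rewrite -subr_eq0 opprK; apply/eqP.
  by rewrite /m cmulBl cmulBl bb ab addrC addrA subrK subrr.
have mb : m ** b = b ** m by rewrite /m cmulBl cmulBr ab.
have mc : m ** c = c ** m by exact: Cc.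
have ma : m ** a = a ** m by rewrite /m cmulBl cmulBr ab.
have xm : x ** m = 0.
  apply: pos_opp_star.
  rewrite starM sm (_ : - _ = (c ** m) ** (c ** m)).
    by apply: pos_sqr; rewrite starM sm sc mc.
  rewrite cmulA -[m ** star x ** x]cmulA -/a mab cmulNx opprK -cc.
  by rewrite -{1}mc !cmulA.
have am : a ** m = 0 by rewrite /a -cmulA xm cmulx0.
have mm : star m ** m = 0.
  by rewrite sm {2}/m cmulBr -[m ** b]opprK -mab ma am oppr0 addr0.
by rewrite -(subr0_eq (cstar_eq0 mm : b - a = 0)).
Qed.

Lemma star_sum_eq0 y z : star y ** y + star z ** z = 0 -> y = 0.
Proof.
move=> h; apply: cstar_eq0; apply: pos_anti; first exact: pos_star.
by rewrite -[- _]add0r -h addrAC subrr add0r; exact: pos_star.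
Qed.

(** [k] is the product of the square root and the inverse of [h], each of which commutes with
    whatever commutes with [h]. *)
Lemma inv_sqrt (h : E) : star h = h -> rn (cone - h) < 1 -> exists k,
  [/\ star k = k, k ** k ** h = cone & forall w : E, w ** h = h ** w -> w ** k = k ** w].
Proof.
move=> sh h1.
have [y [sy yy _ yc]] := sqrt_exists sh (ltW h1).
have [w []] := neumann h1; rewrite opprB addrC subrK => hw wh.
have wc z : z ** h = h ** z -> z ** w = w ** z.
  by move=> e; rewrite -[z in LHS]cmul1x -wh -[w ** h ** z]cmulA -e -!cmulA hw cmulx1.
have hy : h ** y = y ** h by apply: yc.
have yw : y ** w = w ** y by apply: wc; rewrite hy.
have sw : star w = w.
  by rewrite -[star w]cmulx1 -hw cmulA -{1}sh -starM hw star1 cmul1x.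
exists (y ** w); split.
- by rewrite starM sy sw yw.
- by rewrite -cmulA -[y ** w ** h]cmulA wh cmulx1 -cmulA -yw cmulA yy hw.
- move=> z zh; rewrite cmulA yc //.
  by rewrite -!cmulA wc.
Qed.

(** Polar decomposition on the corner of [f]. Adding [1 - f] to [star y ** y] gives an element [h]
    near the unit of [E]; its inverse square root [k] commutes with [f] and corrects [y]. The
    inverse [l] of [k] allows [y] to be recovered from [y ** k]. *)
Lemma near_isometry (f y : E) : projection f -> y ** f = y -> rn (f - star y ** y) < 1 ->
  exists k l, [/\ f ** k = k ** f, k ** l = cone & star (y ** k) ** (y ** k) = f].
Proof.
move=> [sf ff] yf hy; pose h := star y ** y + (cone - f).
have fy : f ** star y = star y by rewrite -{1}sf -starM yf.
have hf : f ** h = h ** f.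
  rewrite /h cmulDr cmulDl cmulA fy cmulBr cmulBl ff cmulx1 cmul1x subrr.
  by rewrite -cmulA yf.
have sh : star h = h by rewrite starD starM starK starB star1 sf.
have [|k [sk kkh kc]] := inv_sqrt sh.
  by rewrite [X in rn X](_ : _ = f - star y ** y) // /h; ncring.
have hk : h ** k = k ** h by apply: kc.
have fk := kc _ hf.
exists k, (k ** h); split=> //; first by rewrite cmulA.
rewrite starM sk.
have -> : k ** star y ** (y ** k) = k ** (h - (cone - f)) ** k by rewrite /h; ncring.
have -> : k ** (h - (cone - f)) ** k = k ** (h ** k) - k ** k + k ** (f ** k) by ncring.
rewrite hk fk cmulA kkh.
suff e : k ** k = k ** k ** f + (cone - f) by rewrite {1}e cmulA; ncring.
have hf1 : h ** (cone - f) = cone - f.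
  rewrite /h cmulDl (_ : star y ** y ** (cone - f) = star y ** (y - y ** f)); last by ncring.
  rewrite yf subrr cmulx0 add0r.
  have -> : (cone - f) ** (cone - f) = cone - f - f + f ** f by ncring.
  by rewrite ff subrK.
have e : k ** k ** (cone - f) = cone - f by rewrite -{1}hf1 cmulA kkh cmul1x.
by rewrite -e; ncring.
Qed.
(* If [W V = 1] then [V* V] is bounded below by [|W|^-2]. *)
Lemma isometry_of_left_inv (W V : E) : W ** V = cone ->
  exists k, star (V ** k) ** (V ** k) = cone.
Proof.
move=> WV; pose d := (rn W ^+ 2 + 1)^-1; pose h := star V ** V.
have W0 : 0 <= rn W ^+ 2 by rewrite exprn_ge0 // rn_ge0.
have d0 : 0 < d by rewrite invr_gt0; lra.
have pW : pos (sc 1 - sc d ** (star W ** W)).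
  apply: pos_compl; first by apply: posZ; [exact: ltW|exact: pos_star].
  rewrite rn_scMp // rn_cstar /d mulrC ler_pdivrMr; lra.
have [y [sy yy _ _]] := pos_sqrt pW.
have ph : pos (h - sc d).
  rewrite (_ : h - sc d = star (y ** V) ** (y ** V)); first exact: pos_star.
  rewrite starM sy cmulA -[_ ** y ** y]cmulA yy sc1.
  have -> : star V ** (cone - sc d ** (star W ** W)) ** V =
     h - (star V ** sc d) ** (star W ** (W ** V)) by rewrite /h; ncring.
  by rewrite -scC WV cmulx1 -cmulA -starM WV star1 cmulx1.
(* From [h - d >= 0], [h] lies within [s] of [s + d], so [h / (s + d)] is at distance less than 1
   from the unit. *)
set s := rn (h - sc d).
have s0 : 0 <= s by exact: rn_ge0.
have hs : rn (sc (s + d) - h) <= s.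
  rewrite [X in rn X](_ : _ = sc s - (h - sc d)); last by rewrite scD; ncring.
  exact: pos_bound.
have T0 : 0 < s + d by lra.
have sh : star h = h by rewrite starM starK.
have [||k [sk kkh kc]] := @inv_sqrt (sc (s + d)^-1 ** h).
- by rewrite starM star_sc sh scC.
- rewrite (_ : cone - _ = sc (s + d)^-1 ** (sc (s + d) - h)); last first.
    by rewrite cmulBr -scM mulVf ?sc1 // gt_eqF.
  rewrite rn_scMp ?invr_gt0 // mulrC ltr_pdivrMr //; lra.
have r0 : 0 < Num.sqrt (s + d) by rewrite sqrtr_gt0.
exists (sc (Num.sqrt (s + d))^-1 ** k); set r := Num.sqrt _ in r0 *.
set g := sc _ ** h in kkh kc.
have gk : g ** k = k ** g by apply: kc.
rewrite !starM sk star_sc.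
have -> : k ** sc r^-1 ** star V ** (V ** (sc r^-1 ** k)) =
  k ** (sc r^-1 ** (h ** sc r^-1)) ** k by rewrite /h; ncring.
rewrite -[h ** sc _]scC [sc _ ** (sc _ ** h)]cmulA -scM -invfM -expr2 sqr_sqrtr ?ltW // -/g.
by rewrite -cmulA gk cmulA.
Qed.

End Positive.

(** * Projections and purely infinite simple algebras *)

Section Projections.
Context {R : realType} {E : cstarAlgType R}.
Implicit Types (x y z p q v : E) (D S : set E).

Lemma closure_rnP S x :
  closure S x <-> forall e : R, 0 < e -> exists2 y, S y & rn (x - y) < e.
Proof.
split=> [h e e0|h U /nbhs_ballP[e e0 eU]].
  have [y [Sy]] := h _ (nbhsx_ballx x e%:C (ltac:(by rewrite ltcR))).
  by rewrite -ball_normE /= rnE ltcR => hy; exists y.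
have e1 : e = (complex.Re e)%:C by rewrite RRe_real // gtr0_real.
have e2 : 0 < complex.Re e by rewrite -ltcR -e1.
have [y Sy hy] := h _ e2; exists y; split=> //; apply: eU.
by rewrite -ball_normE /= rnE e1 ltcR.
Qed.

Lemma partial_isometryP v p : projection p -> star v ** v = p -> v ** p = v.
Proof.
move=> [sp pp] vp; apply/esym/subr0_eq/cstar_eq0.
rewrite starB starM sp.
have -> : (star v - p ** star v) ** (v - v ** p) = (star v ** v) - (star v ** v) ** p
  - p ** (star v ** v) + p ** (star v ** v) ** p by ncring.
by rewrite vp !pp subrr sub0r addNr.
Qed.

Lemma range_projection v p : projection p -> star v ** v = p -> projection (v ** star v).
Proof.
move=> hp vp; split; first by rewrite starM starK.
by rewrite cmulA -[v ** star v ** v]cmulA vp (partial_isometryP hp vp).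
Qed.

Lemma rn_projection p : projection p -> rn p <= 1.
Proof.
move=> [sp pp]; have := rn_cstar p; rewrite sp pp.
by have := rn_ge0 p; nra.
Qed.

Lemma rn_mul_projectionr x p c : projection p -> rn x < c -> rn (x ** p) < c.
Proof.
move=> /rn_projection p1; apply: le_lt_trans; apply: le_trans (rnM _ _) _.
exact: ler_piMr (rn_ge0 _) p1.
Qed.

Lemma rn_mul_projectionl x p c : projection p -> rn x < c -> rn (p ** x) < c.
Proof.
move=> /rn_projection p1; apply: le_lt_trans; apply: le_trans (rnM _ _) _.
exact: ler_piMl (rn_ge0 _) p1.
Qed.

Lemma projection1 : projection (cone : E).
Proof. by split; [exact: star1|rewrite cmulx1]. Qed.

Lemma projection_mulC p q : projection p -> projection q -> q ** p = p -> p ** q = p.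
Proof. by move=> [sp _] [sq _] h; rewrite -{1}sp -sq -starM h sp. Qed.

Lemma projectionB p q : projection p -> projection q -> q ** p = p -> projection (q - p).
Proof.
move=> hp hq h; have h' := projection_mulC hp hq h.
case: hp hq => sp pp [sq qq]; split; first by rewrite starB sp sq.
have -> : (q - p) ** (q - p) = q ** q - q ** p - p ** q + p ** p by ncring.
by rewrite qq h h' pp addrNK.
Qed.

Lemma projectionC p : projection p -> projection (cone - p).
Proof. by move=> hp; apply: projectionB => //; [exact: projection1|rewrite cmul1x]. Qed.

Lemma projectionD p q : projection p -> projection q -> p ** q = 0 -> projection (p + q).
Proof.
move=> [sp pp] [sq qq] pq; split; first by rewrite starD sp sq.
have qp : q ** p = 0 by rewrite -sp -sq -starM pq star0.
by rewrite cmulDl !cmulDr pp qq pq qp addr0 add0r.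
Qed.

(** Compressing [q = p + (q - p)] by [1 - q] writes 0 as a sum of two positive terms, so both vanish
    and [p (1 - q) = 0]. *)
Lemma le_in_projection D p q : projection p -> projection q -> le_in D p q -> q ** p = p.
Proof.
move=> [sp pp] [sq qq] [y _ hy].
have e : p ** (cone - q) = 0.
  apply: (@star_sum_eq0 _ _ _ (y ** (cone - q))).
  rewrite !starM starB star1 sq sp.
  have -> : (cone - q) ** p ** (p ** (cone - q)) +
     (cone - q) ** star y ** (y ** (cone - q)) =
     (cone - q) ** (p ** p + star y ** y) ** (cone - q) by ncring.
  rewrite pp -hy [p + _]addrC subrK.
  have -> : (cone - q) ** q ** (cone - q) = (q - q ** q) ** (cone - q) by ncring.
  by rewrite qq subrr cmul0x.
have pq : p = p ** q by apply: subr0_eq; rewrite -e; ncring.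
by rewrite {2}pq -{1}sq -{1}sp -starM -pq sp.
Qed.

(** The set is the corner [q E q]. For heredity, an element below one of the corner is compressed to
    0 by [1 - q], again because a vanishing sum of positives vanishes termwise. *)
Lemma corner_hereditary q : projection q ->
  hereditary setT [set x | q ** x = x /\ x ** q = x].
Proof.
move=> [sq qq]; split=> //; last first.
  move=> x y [a _ xa] /= [qy yq] [b _ bxy].
  have aq : a ** (cone - q) = 0.
    apply: (@star_sum_eq0 _ _ _ (b ** (cone - q))).
    rewrite !starM starB star1 sq.
    have -> : (cone - q) ** star a ** (a ** (cone - q)) +
     (cone - q) ** star b ** (b ** (cone - q)) =
     (cone - q) ** (star a ** a + star b ** b) ** (cone - q) by ncring.
    rewrite -bxy -xa [x + _]addrC subrK.
    by rewrite -cmulA cmulBr yq cmulx1 subrr cmulx0.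
  have aq' : a = a ** q by apply: subr0_eq; rewrite -aq; ncring.
  have qa : q ** star a = star a by rewrite -{1}sq -starM -aq'.
  by rewrite xa; split; [rewrite cmulA qa|rewrite -cmulA -aq'].
split.
- have q1 := rn_projection (conj sq qq).
  have key (f : E -> E) : (forall x y, rn (f x - f y) <= rn (x - y)) ->
      forall x, closure [set x | q ** x = x /\ x ** q = x] x ->
      (forall y, q ** y = y -> y ** q = y -> f y = y) -> f x = x.
    move=> fl x /closure_rnP hx hf; apply/subr0_eq/rn_small => e e0.
    have [y /= [h1 h2] hy] := hx (e / 2) (ltac:(lra)).
    have -> : f x - x = (f x - f y) - (x - y) by rewrite (hf y) //; ncring.
    by apply: le_trans (rnB _ _) _; have := fl x y; lra.
  by move=> x hx; split; [apply: (key (cmul q))|apply: (key (fun z => z ** q))] => //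
    y z; rewrite -?cmulBl -?cmulBr; apply: le_trans (rnM _ _) _;
    have := rn_ge0 (y - z); have := rn_ge0 q; nra.
- split.
  + by rewrite /= cmulx0 cmul0x.
  + by move=> x y /= [h1 h2] [h3 h4]; rewrite cmulDr cmulDl h1 h2 h3 h4.
  + by move=> a x /= [h1 h2]; rewrite cmulZr cmulZl h1 h2.
- by move=> x y /= [h1 h2] [h3 h4]; rewrite cmulA h1 -cmulA h4.
- by move=> x /= [h1 h2]; split; rewrite -{1}sq -starM ?h1 ?h2.
Qed.

(** The algebraic two-sided ideal generated by [r], built one term at a time for the induction in
    [gen_ideal_factor]. *)
Inductive gen_ideal (r : E) : E -> Prop :=
| gen_ideal0 : gen_ideal r 0
| gen_idealD x a b : gen_ideal r x -> gen_ideal r (x + a ** r ** b).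

Lemma gen_ideal_add r x y : gen_ideal r x -> gen_ideal r y -> gen_ideal r (x + y).
Proof.
move=> hx; elim=> [|z a b _ ih]; first by rewrite addr0.
by rewrite addrA; exact: gen_idealD.
Qed.

Lemma gen_idealM r x u v : gen_ideal r x -> gen_ideal r (u ** x ** v).
Proof.
elim=> [|z a b _ ih]; first by rewrite cmulx0 cmul0x; exact: gen_ideal0.
rewrite (_ : _ ** _ = u ** z ** v + (u ** a) ** r ** (b ** v)); last by ncring.
exact: gen_idealD.
Qed.

Lemma closure_gen_ideal r : closed_ideal setT (closure (gen_ideal r)).
Proof.
have lip u v x : closure (gen_ideal r) x -> closure (gen_ideal r) (u ** x ** v).
  move=> /closure_rnP h; apply/closure_rnP => e e0.
  have K0 : 0 < rn u * rn v + 1.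
    by have := rn_ge0 u; have := rn_ge0 v; nra.
  have [y gy hy] := h (e / (rn u * rn v + 1)) (divr_gt0 e0 K0).
  exists (u ** y ** v); first exact: gen_idealM.
  move: hy; rewrite ltr_pdivlMr // => hy.
  rewrite -cmulBl -cmulBr; apply: le_lt_trans (rnM _ _) _.
  have := rnM u (x - y); have := rn_ge0 v; have := rn_ge0 (x - y); nra.
split=> //; first exact: closed_closure.
- split.
  + by apply/closure_rnP => e e0; exists 0; [exact: gen_ideal0|rewrite subrr rn0].
  + move=> x y /closure_rnP hx /closure_rnP hy; apply/closure_rnP => e e0.
    have e2 : 0 < e / 2 by lra.
    have [x' gx hx'] := hx _ e2; have [y' gy hy'] := hy _ e2.
    exists (x' + y'); first exact: gen_ideal_add.
    rewrite opprD addrACA; apply: le_lt_trans (rnD _ _) _; lra.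
  + by move=> a x /(lip (a *: cone) cone); rewrite cmulx1 cmulZl cmul1x.
- move=> x y _ hy; split.
  + by have := lip x cone y hy; rewrite cmulx1.
  + by have := lip cone x y hy; rewrite cmul1x.
Qed.

(** By simplicity the closed ideal is everything, so the algebraic one contains an element at
    distance less than 1 from the unit, which is invertible. *)
Lemma simple_gen_ideal r : simple_cstar [set: E] -> r <> 0 -> gen_ideal r cone.
Proof.
move=> [_ simp] r0.
have gr : gen_ideal r r.
  by have := gen_idealD cone cone (gen_ideal0 r); rewrite cmulx1 cmul1x add0r.
have [J0|JT] := simp _ (closure_gen_ideal r).
  by case: r0; have := @subset_closure _ (gen_ideal r) r gr; rewrite J0; exact: id.
have : closure (gen_ideal r) cone by rewrite JT.
move=> /closure_rnP /(_ 1 ltr01)[x gx hx].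
have [w [_]] := neumann hx; rewrite opprB addrC subrK => wx.
by have := gen_idealM w cone gx; rewrite cmulx1 wx.
Qed.

(* The isometry [s] of [p E p] moves [r = p - s s*] to the pairwise orthogonal
   projections [s^n r s^n*], so a finite sum of elements [a r b] is a product [W V]. *)
Lemma gen_ideal_factor p s r x : projection p -> star s ** s = p -> p ** s = s ->
  r = p - s ** star s -> gen_ideal r x ->
  exists W V, [/\ x = W ** V, p ** V = V & projection r].
Proof.
move=> hp ss ps rE; have [sp pp] := hp.
have sp' : s ** p = s by exact: partial_isometryP.
have hr : projection r.
  rewrite rE; apply: projectionB => //; first exact: range_projection hp ss.
  by rewrite cmulA ps.
have pr : p ** r = r by rewrite rE cmulBr pp cmulA ps.
have rs : r ** s = 0 by rewrite rE cmulBl ps -cmulA ss sp' subrr.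
have sr : star s ** r = 0 by case: hr => sr _; rewrite -sr -starM rs star0.
(* The power [s^N] inside the corner, whose unit [p] is the zeroth power. *)
pose pw N := iter N (fun z => z ** s) p.
have pwp N : pw N ** p = pw N by case: N => [|N] //=; rewrite -cmulA sp'.
have ppw N : p ** pw N = pw N by elim: N => [|N ih] //=; rewrite cmulA ih.
have pwpw N : star (pw N) ** pw N = p.
  elim: N => [|N ih] /=; first by rewrite sp.
  by rewrite starM cmulA -[_ ** _ ** pw N]cmulA ih -[star s ** p ** s]cmulA ps.
(* The last two clauses say that [W] and [V] use only the copies of [r] numbered below [N], so a new
   term placed on copy [N] does not interact with them. *)
move=> gx; suff : exists N W V, [/\ x = W ** V, p ** V = V, W ** pw N = 0
    & star (pw N) ** V = 0] by move=> [N [W [V [h1 h2 _ _]]]]; exists W, V.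
elim: gx => [|y a b _ [N [W [V [-> pV W0 V0]]]]].
  by exists 0%N, 0, 0; rewrite !cmulx0 cmul0x.
exists N.+1, (W + a ** r ** star (pw N)), (V + pw N ** r ** b); split.
- have -> : (W + a ** r ** star (pw N)) ** (V + pw N ** r ** b) = W ** V +
    (W ** pw N) ** (r ** b) + a ** r ** (star (pw N) ** V) +
    a ** r ** ((star (pw N) ** pw N) ** r) ** b by ncring.
  rewrite W0 V0 pwpw pr cmul0x cmulx0 !addr0.
  by case: hr => _ rr; rewrite -[a ** r ** r]cmulA rr.
- by rewrite cmulDr pV !cmulA ppw.
- rewrite /= cmulDl cmulA W0 cmul0x add0r cmulA -[_ ** star _ ** _]cmulA pwpw.
  by rewrite -!cmulA ps rs cmulx0.
- rewrite /= starM cmulDr -cmulA V0 cmulx0 add0r !cmulA -[_ ** star _ ** _]cmulA.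
  by rewrite pwpw -[star s ** p ** r]cmulA pr sr cmul0x.
Qed.

(** The corner of [q] contains an infinite projection [p], with [s] from [p] onto a proper [p'].
    Simplicity gives [1 = W V] with [V] under [p], and [s V] still has a left inverse, so it can be
    corrected to an isometry. The factor [s] keeps the range under [p'], hence different from
    [q]. *)
Lemma purely_infinite_isometry q : purely_infinite [set: E] -> projection q -> q <> 0 ->
  exists w, [/\ star w ** w = cone, q ** w = w & w ** star w <> q].
Proof.
move=> [simp pinf] hq q0; have [sq qq] := hq.
have [|p /= [qp pq] [_ hp [p' [_ hp' lep ne [s _ [ps sp']]]]]] :=
    pinf _ (corner_hereditary hq).
  by move=> /seteqP[/(_ q) /= h _]; apply/q0/h.
have pp' : p ** p' = p' by exact: le_in_projection hp' hp lep.
have [_ pp] := hp.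
have es : p ** s = s.
  apply/esym/subr0_eq; rewrite -[LHS]starK -[RHS]star0; congr (star _).
  apply: cstar_eq0; rewrite starK starB starM.
  have -> : (s - p ** s) ** (star s - star s ** star p) =
    (s ** star s) - p ** (s ** star s) - ((s ** star s) - p ** (s ** star s)) ** star p.
    by ncring.
  by rewrite -sp' pp' subrr cmul0x subrr.
have r0 : p - p' <> 0 by move=> /subr0_eq e; apply: ne.
have gen1 := simple_gen_ideal simp r0.
have [W [V [WV pV hr]]] := gen_ideal_factor hp (esym ps) es
  (congr1 (fun z => p - z) sp') gen1.
have [|k hk] := @isometry_of_left_inv _ _ (W ** star s) (s ** V).
  by rewrite cmulA -[_ ** _ ** s]cmulA -ps -cmulA pV.
exists (s ** V ** k); split=> //.
  by rewrite -es !cmulA qp.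
move=> e; apply: r0.
have rq : (p - p') ** q = p - p'.
  by rewrite cmulBl pq -{1}(projection_mulC hp' hp pp') -cmulA pq projection_mulC.
rewrite -rq -e !cmulA [_ ** s]cmulBl es sp' -[s ** star s ** s]cmulA -ps.
by rewrite (partial_isometryP hp (esym ps)) subrr !cmul0x.
Qed.

End Projections.

(** * Traces and the main comparison *)

Section Traces.
Context {R : realType} {E : cstarAlgType R} (B : set E).
Hypothesis hB : closed_ideal [set: E] B.
Hypothesis Bstar : forall x, B x -> B (star x).
Implicit Types (x y z e f g p q v : E) (tau : E -> \bar R).

Lemma ideal_mull x y : B y -> B (x ** y).
Proof. by case: hB => _ _ _ h By; have [] := h x y I By. Qed.

Lemma ideal_mulr x y : B x -> B (x ** y).
Proof. by case: hB => _ _ _ h Bx; have [] := h y x I Bx. Qed.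

Lemma ideal_add x y : B x -> B y -> B (x + y).
Proof. by case: hB => _ _ [_ h _] _; exact: h. Qed.

Lemma ideal_sub x y : B x -> B y -> B (x - y).
Proof.
move=> Bx By; apply: ideal_add => //.
by rewrite (_ : - y = - cone ** y); [exact: ideal_mull|ncring].
Qed.

Lemma projection_positive p : B p -> projection p -> positive_in B p.
Proof. by move=> Bp [sp pp]; exists p => //; rewrite sp pp. Qed.

(** Density gives a positive [x = star y ** y] of finite trace within 1/2 of [e], so [e x e]
    dominates [e / 2]. The trace property moves [e x e] to [y e star y], a summand of [y ** star y],
    whose trace is that of [x]. *)
Lemma trace_projection_fin tau e : densely_defined_trace B tau ->
  B e -> projection e -> tau e \is a fin_num.
Proof.
move=> [tau0 tauD tauZ tauC tdense] Be he; have [se ee] := he.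
have pe := projection_positive Be he.
suff : (tau e < +oo)%E.
  by move=> h; rewrite fin_numE (lt_eqF h) andbT gt_eqF // (lt_le_trans _ (tau0 _ pe)).
have h2 : 0 < 2^-1 :> R by rewrite invr_gt0.
have [x [[y By xE] tx] hx] := (closure_rnP _ _).1 (tdense _ pe) _ h2.
have rx : rn (e - e ** x ** e) <= 2^-1.
  have : e ** ((e - x) ** e) = e ** e ** e - e ** x ** e by ncring.
  rewrite !ee => <-.
  have := rnM e ((e - x) ** e); have := rnM (e - x) e; have := rn_projection he.
  by have := rn_ge0 e; have := rn_ge0 (e - x); nra.
pose a := y ** e; pose b := y ** (cone - e).
have Ba : B a by exact: ideal_mulr.
have Bb : B b by rewrite /b cmulBr cmulx1; exact: (ideal_sub By Ba).
have aa : star a ** a = e ** x ** e by rewrite /a starM se xE; ncring.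
have ta : (tau (star a ** a) < +oo)%E.
  apply: le_lt_trans tx; rewrite xE tauC // [leRHS]tauC //.
  rewrite (_ : y ** star y = a ** star a + b ** star b).
    rewrite tauD; last 2 first.
    - by exists (star a); rewrite ?starK //; exact: Bstar.
    - by exists (star b); rewrite ?starK //; exact: Bstar.
    rewrite leeDl // tau0 //.
    by exists (star b); rewrite ?starK //; exact: Bstar.
  rewrite /a /b !starM starB star1 se.
  have -> : y ** e ** (e ** star y) + y ** (cone - e) ** ((cone - e) ** star y) =
    y ** (e ** e) ** star y + y ** (cone - e - e + e ** e) ** star y by ncring.
  by rewrite ee; ncring.
have sx : star x = x by rewrite xE starM starK.
(* Compressing [m m] by [e] yields [e x e = e / 2 + star (m e) ** (m e)]. *)
have [|m [sm mm _ _]] := @pos_sqrt _ _ (sc 2^-1 - (e - e ** x ** e)).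
  split; first by rewrite !starB star_sc !starM se sx cmulA.
  by exists 2^-1 => //; rewrite opprB addrC subrK.
have e2 : star a ** a = sc 2^-1 ** e + star (m ** e) ** (m ** e).
  rewrite aa (starM m e) sm se.
  have -> : e ** m ** (m ** e) = e ** (m ** m) ** e by ncring.
  rewrite mm cmulBr -scC cmulBl -[sc _ ** e ** e]cmulA ee.
  have -> : e ** (e - e ** x ** e) ** e = e ** e ** e - (e ** e) ** x ** (e ** e) by ncring.
  have hh : sc 2^-1 + sc 2^-1 = cone :> E by rewrite scal_half.
  transitivity ((sc 2^-1 + sc 2^-1) ** e - e + e ** x ** e); last by rewrite !ee; ncring.
  by rewrite hh; ncring.
have Bme : B (m ** e) by exact: ideal_mull.
move: ta; rewrite e2 tauD; last 2 first.
- exists (sc (Num.sqrt 2^-1) ** e); first exact: ideal_mull.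
  rewrite starM star_sc se cmulA -[e ** _ ** _]cmulA -scM -scC.
  by rewrite -expr2 sqr_sqrtr ?invr_ge0 // -cmulA ee.
- by exists (m ** e).
rewrite scE tauZ ?invr_ge0 //.
have : (0 <= tau (star (m ** e) ** (m ** e)))%E by apply: tau0; exists (m ** e).
have h2' : (0 < (2^-1)%:E :> \bar R)%E by rewrite lte_fin.
case: (tau (star (m ** e) ** _)) => [t| |] // t0;
  by case: (tau e) => [r| |]; rewrite ?ltry // gt0_muley.
Qed.

Lemma traceD_projection tau p q : densely_defined_trace B tau ->
  B p -> projection p -> B q -> projection q -> tau (p + q) = (tau p + tau q)%E.
Proof. by move=> [_ tauD _ _ _] ? ? ? ?; apply: tauD; exact: projection_positive. Qed.

(** The approximate unit is not assumed increasing, so [e_m] need not lie under [e_n]. For large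
    [n], however, [e_n e_m] is close to [e_m] and its polar part [v] carries [e_m] onto a
    subprojection of [e_n]; removing that range costs only [tau_i (e_m)], which is finite. *)
Lemma orthogonal_large_projection k (tau : 'I_k -> E -> \bar R) (e : nat -> E) m g :
  (forall i, densely_defined_trace B (tau i)) ->
  approximate_unit B e -> (forall n, projection (e n)) ->
  (forall i, (fun n => tau i (e n)) @ \oo --> +oo%E) -> B g -> projection g ->
  exists s, [/\ B s, projection s, s ** e m = 0 & forall i, (tau i g < tau i s)%E].
Proof.
move=> htau [eB eunit] he etau Bg hg.
have Be n : B (e n) by case: (eB n).
have fin i p : B p -> projection p -> tau i p \is a fin_num.
  by move=> Bp hp; exact: (@trace_projection_fin (tau i)).
have [N1 hN1] := cvg_tends (eunit _ (Be m)).1 ltr01.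
have hi i : exists N, forall n, (N <= n)%N -> (tau i g + tau i (e m) < tau i (e n))%E.
  have fg := fin i g Bg hg; have fe := fin i _ (Be m) (he m).
  have /cvgeyPgt/(_ (fine (tau i g) + fine (tau i (e m))))[N _ hN] := etau i.
  by exists N => n /hN /=; rewrite EFinD !fineK.
have [N hN] := choice hi.
pose n := maxn N1 (\max_i N i).
have hn i : (tau i g + tau i (e m) < tau i (e n))%E.
  by apply: hN; rewrite leq_max (leq_bigmax i) orbT.
have {}hN1 := hN1 n (leq_maxl _ _).
have [sm mm] := he m; have [sn nn] := he n.
have [||k' [l [ck kl vv]]] := @near_isometry _ _ (e m) (e n ** e m) (he m).
- by rewrite -cmulA mm.
- rewrite starM sm sn.
  have -> : e m ** e n ** (e n ** e m) = e m ** (e n ** e n ** e m) by ncring.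
  by rewrite nn -{1}mm -cmulBr rn_mul_projectionl // rnBC.
set v := _ ** k' in vv.
have nv : e n ** v = v by rewrite /v !cmulA nn.
have Bv : B v by rewrite /v -cmulA; exact: ideal_mulr.
have hvv := range_projection (he m) vv.
have hs : projection (e n - v ** star v) by apply: projectionB => //; rewrite cmulA nv.
have Bvv : B (v ** star v) by exact: ideal_mulr.
have Bs : B (e n - v ** star v) by exact: ideal_sub.
exists (e n - v ** star v); split=> //.
- have sn' : (e n - v ** star v) ** e n = e n - v ** star v.
    have vn : star v ** e n = star v by rewrite -{1}sn -starM nv.
    by rewrite cmulBl nn -cmulA vn.
  have sv : (e n - v ** star v) ** v = 0.
    by rewrite cmulBl nv -cmulA vv partial_isometryP // subrr.
  (* The difference [e_n - v v*] absorbs [e_n] on its right, and it kills [e_n e_m], which equals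
     [v l]. *)
  rewrite -sn' -cmulA -[e n ** e m]cmulx1 -kl [_ ** (k' ** l)]cmulA -/v.
  by rewrite cmulA sv cmul0x.
- move=> i; have := hn i.
  have -> : tau i (e n) = (tau i (e n - v ** star v)%R + tau i (e m))%E.
    rewrite -vv; have [_ _ _ -> // _] := htau i.
    by rewrite -(traceD_projection (htau i)) // subrK.
  by rewrite lteD2rE // fin.
Qed.

End Traces.

(** * Lifting isometries from the quotient *)

Section Quotient.
Context {R : realType} {E A : cstarAlgType R} (B : set E) (pi : {linear E -> A}).
Hypothesis hB : closed_ideal [set: E] B.
Hypothesis hpi : is_quotient B pi.

Lemma quotM x y : pi (x ** y) = pi x ** pi y.
Proof. by case: hpi => -[h _] _ _ _ _; exact: h. Qed.

Lemma quot_star x : pi (star x) = star (pi x).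
Proof. by case: hpi => -[_ h] _ _ _ _; exact: h. Qed.

Lemma quot_surj y : exists x, pi x = y.
Proof. by case: hpi => _ h _ _ _; exact: h. Qed.

Lemma quot_eq0 x : pi x = 0 <-> B x.
Proof. by case: hpi => _ _ h _ _; exact: h. Qed.

Lemma quot1 : pi cone = cone.
Proof.
by have [x hx] := quot_surj cone; rewrite -[LHS]cmulx1 -hx -quotM cmul1x.
Qed.

Lemma quot_projection p : projection p -> projection (pi p).
Proof. by move=> [sp pp]; split; rewrite -?quot_star -?quotM ?sp ?pp. Qed.

Lemma ideal_star x : B x -> B (star x).
Proof. by move=> /quot_eq0 h; apply/quot_eq0; rewrite quot_star h star0. Qed.

Hypothesis pinf : purely_infinite [set: A].

Hypothesis hPC : property_PC B.

(** [g] is carried into [s] by trace comparison, and [s] into [r] by the polar part of [r a s]; [u]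
    is the composite. *)
Lemma ideal_projection_sub r g : projection r -> ~ B r -> projection g -> B g ->
  exists u, [/\ B u, star u ** u = g & r ** u = u].
Proof.
move=> hr nBr hg Bg; have [sr rr] := hr.
have [|w [ww rw _]] := purely_infinite_isometry pinf (quot_projection hr).
  by move/quot_eq0.
have [a aw] := quot_surj w; pose b := cone - star a ** r ** a.
have Bb : B b.
  apply/quot_eq0; rewrite linearB quotM quotM quot_star quot1 aw -cmulA rw ww.
  exact: subrr.
have [_ _ _ [k [tau [htau [e [eu he etau]] comp]]]] := hPC.
have [m /(_ m (leqnn m)) hm] := cvg_tends (eu.2 _ Bb).1 ltr01.
have [s [Bs hs se hts]] := orthogonal_large_projection hB ideal_star m htau eu he etau Bg hg.
have [ss s2] := hs.
have [||k' [l [_ _ vv]]] := @near_isometry _ _ s (r ** a ** s) hs.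
- by rewrite -cmulA s2.
- rewrite !starM sr ss.
  have -> : s ** (star a ** r) ** (r ** a ** s) = s ** (star a ** (r ** r) ** a) ** s by ncring.
  rewrite rr (_ : star a ** r ** a = cone - b); last by rewrite /b; ncring.
  have -> : s - s ** (cone - b) ** s = s - s ** s + s ** b ** s by ncring.
  rewrite s2 subrr add0r.
  (* Orthogonality of [s] to [e_m] removes the large part of [b]. *)
  have -> : s ** b ** s = s ** (b - e m ** b) ** s + (s ** e m) ** b ** s by ncring.
  by rewrite se !cmul0x addr0 rn_mul_projectionr // rn_mul_projectionl // rnBC.
set v := _ ** k' in vv.
have rv : r ** v = v by rewrite /v !cmulA rr.
have Bv : B v by rewrite /v -cmulA; apply: ideal_mull => //; apply: ideal_mulr.
have [q' [_ hq' leq' [v1 Bv1 [gE q'E]]]] := comp _ _ Bg hg Bs hs hts.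
have sq' := le_in_projection hq' hs leq'.
have qv : q' ** v1 = v1.
  by rewrite q'E -cmulA -gE; apply: partial_isometryP.
exists (v ** v1); split.
- exact: ideal_mull.
- rewrite starM cmulA -[star v1 ** _ ** v]cmulA vv -cmulA.
  by rewrite (_ : s ** v1 = v1) // -{1}qv cmulA sq' qv.
- by rewrite cmulA rv.
Qed.

(** The isometry is [v + u] with [star v ** v = 1 - g] and [star u ** u = g], the two ranges being
    orthogonal under [q]. As [u] lies in [B], adding it does not change the image in the quotient of
    what remains of [q]. *)
Lemma exists_isometry q : projection q -> ~ B q ->
  exists V, [/\ star V ** V = cone, q ** V = V & ~ B (q - V ** star V)].
Proof.
move=> hq nBq; have [sq qq] := hq.
have [|w [ww qw wne]] := purely_infinite_isometry pinf (quot_projection hq).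
  by move/quot_eq0.
have [x [qx xw]] : exists x, q ** x = x /\ pi x = w.
  have [x xw] := quot_surj w; exists (q ** x).
  by rewrite cmulA qq quotM xw qw.
pose c := cone - star x ** x.
have Bc : B c.
  by apply/quot_eq0; rewrite linearB quotM quot_star quot1 xw ww; exact: subrr.
have [_ _ _ [k [tau [_ [e [eu he _]] _]]]] := hPC.
have [m /(_ m (leqnn m)) hm] := cvg_tends (eu.2 _ Bc).1 ltr01.
have Bg : B (e m) by case: eu => /(_ m) [].
set g := e m in hm Bg; have hg : projection g := he m.
have hf := projectionC hg; have [sf ff] := hf; set f := cone - g in hf sf ff.
have pif : pi f = cone.
  by rewrite linearB quot1 (quot_eq0 g).2 //; exact: subr0.
have [||k' [l [fk kl vv]]] := @near_isometry _ _ f (x ** f) hf.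
- by rewrite -cmulA ff.
- rewrite starM sf (_ : f ** star x ** (x ** f) = f ** f - f ** c ** f); last first.
    by rewrite /c; ncring.
  rewrite ff opprB addrC subrK (_ : f ** c ** f = (c - g ** c) ** f); last first.
    by rewrite /f; ncring.
  by rewrite rn_mul_projectionr // rnBC.
set v := _ ** k' in vv.
have qv : q ** v = v by rewrite /v !cmulA qx.
have vf : v ** f = v by exact: partial_isometryP.
have piv : pi v = w ** pi k' by rewrite /v !quotM xw pif cmulx1.
pose r := q - v ** star v.
have hr : projection r.
  by apply: projectionB => //; [exact: range_projection hf vv|rewrite cmulA qv].
have hww : projection (w ** star w) by apply: range_projection ww; exact: projection1.
have nBr : ~ B r.
  (* Otherwise [pi q] would be [pi v ** star (pi v)] with [pi v = w ** pi k']; then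
     [pi q - w ** star w] would annihilate [pi q], forcing [w ** star w = pi q]. *)
  move/quot_eq0; rewrite linearB quotM quot_star piv => /subr0_eq piq.
  apply: wne; apply/esym/subr0_eq.
  have -> : pi q - w ** star w = (pi q - w ** star w) ** pi q.
    rewrite cmulBl (projection_mulC hww (quot_projection hq)); last by rewrite cmulA qw.
    by rewrite -quotM qq.
  rewrite {2}piq starM.
  have -> : (pi q - w ** star w) ** (w ** pi k' ** (star (pi k') ** star w)) =
   ((pi q ** w) - w ** (star w ** w)) ** (pi k' ** (star (pi k') ** star w)) by ncring.
  by rewrite qw ww cmulx1 subrr cmul0x.
have [u [Bu uu ru]] := ideal_projection_sub hr nBr hg Bg.
have vr : star v ** r = 0.
  by rewrite /r cmulBr cmulA vv -{1}sq -starM qv -{1}vf starM sf subrr.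
have vu : star v ** u = 0 by rewrite -ru cmulA vr cmul0x.
have uv : star u ** v = 0 by rewrite -[LHS]starK starM starK vu star0.
have qr : q ** r = r by rewrite /r cmulBr qq cmulA qv.
exists (v + u); split.
- rewrite starD cmulDl !cmulDr vv vu uv uu addr0 add0r /f; ncring.
- by rewrite cmulDr qv -ru cmulA qr.
- move/quot_eq0 => h; apply/nBr/quot_eq0; rewrite -[RHS]h.
  have u0 : pi u = 0 by apply/quot_eq0.
  have vuE : pi (v + u) = pi v by rewrite linearD u0; exact: addr0.
  have pir y : pi (q - y ** star y) = pi q - pi y ** star (pi y).
    by rewrite linearB quotM quot_star.
  by rewrite !pir vuE.
Qed.

End Quotient.

(** * The Grothendieck group *)

Section MonoidIdeal.
Variables (M : nmodType) (N : M -> Prop).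
Hypothesis N_ex : exists a, N a.
Hypothesis N_add : forall a b, N a -> N (a + b).
Hypothesis N_sub : forall a b, N a -> N b -> exists2 c, N c & a + c = b.

(** A solution of [a0 + z = a0] is neutral for every [a0 + c], and these exhaust [N]. *)
Lemma ideal_neutral : exists2 z, N z & forall a, N a -> z + a = a.
Proof.
have [a0 h0] := N_ex; have [z hz a0z] := N_sub h0 h0.
exists z => // b hb; have [c _ <-] := N_sub h0 hb.
by rewrite addrA (addrC z) a0z.
Qed.

Lemma groth_class_ideal_inj a b : N a -> N b ->
  groth_class (a, 0) = groth_class (b, 0) -> a = b.
Proof.
move=> Na Nb /eqP/groth_classP[c /=]; rewrite !addr0 => h.
(* [c] need not lie in [N], but [z + c] does, and [d] is its inverse there. *)
have [z Nz zN] := ideal_neutral; have [d _ zcd] := N_sub (N_add c Nz) Nz.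
have key x : N x -> x = x + c + (z + d).
  move=> Nx; rewrite -{1}(zN x Nx) -{1}zcd.
  by rewrite [LHS](AC 4 ((4*2)*(1*3)))/=.
by rewrite (key a Na) h -key.
Qed.

(** Adding [z] to both entries preserves the formal difference and brings them into [N], where the
    subtraction can be carried out. *)
Lemma groth_class_ideal_surj (u : groth M) : exists2 a, N a & u = groth_class (a, 0).
Proof.
elim/groth_ind: u => -[x y]; have [z Nz _] := ideal_neutral.
have [r Nr hr] := N_sub (N_add y Nz) (N_add x Nz).
exists r => //; apply/eqP/groth_classP; exists z => /=.
by rewrite addr0 addrC -hr addrC -addrA [z + y]addrC.
Qed.
End MonoidIdeal.

(** * Classes of projections of the algebra among those of matrix projections *)

Section VSemigroup.
Context {R : realType} {E : cstarAlgType R}.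
Implicit Types (p q : E).

Definition Vc p (hp : projection p) : @mvn_semigroup R E :=
  V_class (Projmx (projection_mx1 hp)).

Lemma const_mx1M (x y : E) :
  (const_mx (x : cring E) : 'M[cring E]_1) *m (const_mx (y : cring E) : 'M[cring E]_1) =
  const_mx (x ** y : cring E).
Proof. by apply/matrixP => i j; rewrite !mxE big_ord1 !mxE. Qed.

Lemma adj_const_mx1 (x : E) :
  adjmx (const_mx (x : cring E) : 'M[cring E]_1) = const_mx (star x : cring E).
Proof. by apply/matrixP => i j; rewrite !mxE. Qed.

Lemma Vc_eq p q (hp : projection p) (hq : projection q) :
  Vc hp = Vc hq <-> mvn_equiv setT p q.
Proof.
split.
  move=> /eqP/V_classP[v [/matrixP/(_ ord0 ord0) h1 /matrixP/(_ ord0 ord0) h2]].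
  by exists (v ord0 ord0) => //; split; [move: h1|move: h2]; rewrite !mxE big_ord1 !mxE.
move=> [v _ [h1 h2]]; apply/eqP/V_classP; exists (const_mx (v : cring E)).
by rewrite adj_const_mx1 !const_mx1M -h1 -h2.
Qed.

Lemma Vc_isometry p q w (hp : projection p) (hq : projection q) :
  star w ** w = cone -> q = w ** p ** star w -> Vc hp = Vc hq.
Proof.
move=> ww hqE; apply/Vc_eq; have [sp pp] := hp; exists (w ** p) => //.
rewrite starM sp hqE; split.
  by rewrite cmulA -[p ** star w ** w]cmulA ww cmulx1 pp.
by rewrite cmulA -[w ** p ** p]cmulA pp.
Qed.

Lemma projection_conj p w : projection p -> star w ** w = cone ->
  projection (w ** p ** star w).
Proof.
move=> [sp pp] ww; split; first by rewrite !starM starK sp cmulA.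
have -> : w ** p ** star w ** (w ** p ** star w) = w ** p ** (star w ** w) ** p ** star w by ncring.
by rewrite ww cmulx1 -[w ** p ** p]cmulA pp.
Qed.

Lemma Vc_add p q (hp : projection p) (hq : projection q) (hpq : projection (p + q)) :
  p ** q = 0 -> Vc hpq = Vc hp + Vc hq.
Proof.
move=> pq; have [sp pp] := hp; have [sq qq] := hq.
have qp : q ** p = 0 by rewrite -sp -sq -starM pq star0.
rewrite -[RHS]/(V_add _ _) V_class_add; apply/esym/eqP/V_classP.
(* The row [(p, q)] is a partial isometry from [diag(p, q)] onto [p + q]. *)
exists (row_mx (const_mx (p : cring E)) (const_mx (q : cring E))).
rewrite adjmx_row !adj_const_mx1 sp sq mul_col_row mul_row_col !const_mx1M.
rewrite pp qq pq qp; split; last by apply/matrixP => i j; rewrite !mxE.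
by rewrite /dsum /pm_mx /=; congr block_mx; apply/matrixP => i j; rewrite !mxE.
Qed.

(** The row [s] of isometries with orthogonal ranges satisfies [s* s = 1], so conjugation by it
    turns the matrix projection into an equivalent 1 by 1 one. *)
Lemma V_class_compress (P : projmx) (S : 'I_(pm_size P) -> E) :
  (forall i j, star (S i) ** S j = if i == j then cone else 0) ->
  exists p (hp : projection p), V_class P = Vc hp.
Proof.
move=> hS; pose s : 'M[cring E]_(1, pm_size P) := \row_i (S i : cring E).
have ss : adjmx s *m s = 1%:M.
  by apply/matrixP => i j; rewrite !mxE big_ord1 !mxE [LHS]hS; case: eqP.
pose w := s *m pm_mx P.
have w1 : adjmx w *m w = pm_mx P.
  by rewrite adjmxM pm_adj mulmxA -[pm_mx P *m _ *m s]mulmxA ss mulmx1 pm_idem.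
pose Q := w *m adjmx w; pose p : E := Q ord0 ord0.
have QE : Q = const_mx (p : cring E).
  by apply/matrixP => i j; rewrite [RHS]mxE !ord1.
have sQ : adjmx Q = Q by rewrite adjmxM adjmxK.
have QQ : Q *m Q = Q.
  rewrite /Q mulmxA -[w *m adjmx w *m w]mulmxA w1.
  by rewrite /w -[s *m pm_mx P *m pm_mx P]mulmxA pm_idem.
have hp : projection p.
  split.
    by have /matrixP/(_ ord0 ord0) := sQ; rewrite QE adj_const_mx1 !mxE.
  by have /matrixP/(_ ord0 ord0) := QQ; rewrite QE const_mx1M !mxE.
by exists p, hp; apply/eqP/V_classP; exists w; split; [exact: esym w1|exact: esym QE].
Qed.

End VSemigroup.

(** * The semigroup ideal of projections outside the ideal *)

Section KTheory.
Context {R : realType} {E A : cstarAlgType R} (B : set E) (pi : {linear E -> A}).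
Hypothesis hB : closed_ideal [set: E] B.
Hypothesis hpi : is_quotient B pi.
Hypothesis pinf : purely_infinite [set: A].
Hypothesis hPC : property_PC B.

Lemma not_ideal1 : ~ B cone.
Proof.
move=> /(quot_eq0 hpi); rewrite (quot1 hpi) => h.
have [[A0 _] _] := pinf; apply: A0; apply/seteqP; split=> // x _ /=.
by rewrite -[x]cmul1x h cmul0x.
Qed.

(** The induction carries a projection [r] outside [B] and orthogonal to the ranges so far; the next
    isometry is taken under [r] and leaves a remainder outside [B]. *)
Lemma orthogonal_isometries n : exists (S : nat -> E) r,
  [/\ projection r, ~ B r, forall i, (i < n)%N -> r ** S i = 0
    & forall i j, (i < n)%N -> (j < n)%N ->
        star (S i) ** S j = if i == j then cone else 0].
Proof.
elim: n => [|n [S [r [hr nBr rS SS]]]].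
  by exists (fun=> 0), cone; split=> //; [exact: projection1|exact: not_ideal1].
have [V [VV rV nB]] := exists_isometry hB hpi pinf hPC hr nBr.
have [sr rr] := hr.
have VS i : (i < n)%N -> star V ** S i = 0.
  by move=> ni; rewrite -rV starM sr -cmulA rS // cmulx0.
have SV i : (i < n)%N -> star (S i) ** V = 0.
  by move=> ni; rewrite -[LHS]starK starM starK VS // star0.
exists (fun i => if i == n then V else S i), (r - V ** star V); split=> //.
- apply: projectionB => //; last by rewrite cmulA rV.
  by apply: range_projection VV; exact: projection1.
- move=> i; rewrite ltnS leq_eqVlt; case: eqP => [_ _|_ /= ni].
    by rewrite cmulBl rV -cmulA VV cmulx1 subrr.
  by rewrite cmulBl rS // -cmulA VS // cmulx0 subrr.
- move=> i j; rewrite !ltnS (leq_eqVlt i) (leq_eqVlt j).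
  case: (eqVneq i n) => [-> _|ni /= li]; case: (eqVneq j n) => [-> _|nj /= lj].
  + by rewrite ?eqxx.
  + by rewrite ?(eq_sym n) ?(negbTE nj) ?VS.
  + by rewrite ?(negbTE ni) ?SV.
  + exact: SS.
Qed.

Definition Vnon (a : @mvn_semigroup R E) :=
  exists p (hp : projection p), ~ B p /\ a = Vc hp.

Lemma Vc_surj (a : @mvn_semigroup R E) : exists p (hp : projection p), a = Vc hp.
Proof.
elim/(@V_ind R E): a => P; have [S [_ [_ _ _ SS]]] := orthogonal_isometries (pm_size P).
by apply: (@V_class_compress _ _ P S) => i j; rewrite SS.
Qed.

Lemma Vnon_add a b : Vnon a -> Vnon (a + b).
Proof.
move=> [p [hp [nBp ->]]]; have [q [hq ->]] := Vc_surj b.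
have [S [_ [_ _ _ SS]]] := orthogonal_isometries 2.
have s00 := SS 0%N 0%N isT isT; have s11 := SS 1%N 1%N isT isT.
have s01 := SS 0%N 1%N isT isT; rewrite /= in s00 s11 s01.
move: (S 0%N) (S 1%N) s00 s11 s01 => s t ss tt st {S SS}.
have hp' := projection_conj hp ss; have hq' := projection_conj hq tt.
have pq : s ** p ** star s ** (t ** q ** star t) = 0.
  have -> : s ** p ** star s ** (t ** q ** star t) =
    s ** p ** (star s ** t) ** q ** star t by ncring.
  by rewrite st cmulx0 !cmul0x.
have hpq := projectionD hp' hq' pq.
rewrite (Vc_isometry hp hp' ss erefl) (Vc_isometry hq hq' tt erefl) -(Vc_add _ _ hpq) //.
exists _, hpq; split=> // h; apply: nBp.
(* This compression of the sum is [p] itself. *)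
have : B (star s ** (s ** p ** star s + t ** q ** star t) ** s).
  exact: (ideal_mulr hB _ (ideal_mull hB _ h)).
have -> : star s ** (s ** p ** star s + t ** q ** star t) ** s =
  (star s ** s) ** p ** (star s ** s) + (star s ** t) ** q ** star t ** s by ncring.
by rewrite ss st !cmul0x addr0 cmulx1 cmul1x.
Qed.

(** An isometry [V] under [q] moves [p] to an equivalent [p'] below [V V*]. The complement [q - p']
    dominates [q - V V*], which is outside [B], so it is outside [B] too. *)
Lemma Vnon_sub a b : Vnon a -> Vnon b -> exists2 c, Vnon c & a + c = b.
Proof.
move=> [p [hp [nBp ->]]] [q [hq [nBq ->]]].
have [V [VV qV nB]] := exists_isometry hB hpi pinf hPC hq nBq.
have hp' := projection_conj hp VV; set p' := _ ** star V in hp'.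
have qp' : q ** p' = p' by rewrite /p' !cmulA qV.
have hr := projectionB hp' hq qp'; have [_ p'p'] := hp'.
exists (Vc hr).
  exists _, hr; split=> // h; apply: nB.
  have := ideal_mull hB (q - V ** star V) h.
  have [sq qq] := hq.
  have -> : (q - V ** star V) ** (q - p') = q ** q - V ** (star V ** q) - (q ** V -
    V ** (star V ** V)) ** (p ** star V) by rewrite /p'; ncring.
  rewrite qq qV VV cmulx1 subrr cmul0x subr0.
  by rewrite -{2}sq -starM qV.
have hpr : projection (p' + (q - p')) by rewrite addrC subrK.
rewrite (Vc_isometry hp hp' VV erefl) -(Vc_add _ _ hpr).
  by apply/Vc_eq; have [sq qq] := hq; exists q; rewrite // addrC subrK sq qq.
by rewrite cmulBr (projection_mulC hp' hq qp') p'p' subrr.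
Qed.

Lemma Vnon_ex : exists a, Vnon a.
Proof.
by exists (Vc projection1), cone, projection1; split=> //; exact: not_ideal1.
Qed.

End KTheory.

Theorem theorem2p5 (R : realType) (E A : cstarAlgType R) (B : set E)
    (pi : {linear E -> A}) :
  closed_ideal [set: E] B -> is_quotient B pi ->
  simple_cstar [set: A] -> purely_infinite [set: A] ->
  essential_ideal B ->
  separable_set B -> simple_cstar B -> real_rank_zero B -> property_PC B ->
  exists f : set E -> K0 E,
    (forall (p : E) (hp : projection p), ~ B p ->
       f (mvn_class p) = K0_class hp) /\
    set_bij [set mvn_class p | p in [set p | projection p /\ ~ B p]] [set: K0 E] f.
Proof.
move=> hB hpi _ pinf _ _ _ _ hPC.
have classE (p q : E) (hp : projection p) (hq : projection q) :
    mvn_class p = mvn_class q <-> Vc hp = Vc hq.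
  split=> [e|e].
    apply/Vc_eq; have : mvn_class q q by split=> //; exact/(Vc_eq hq hq).
    by rewrite -e => -[].
  by apply/seteqP; split=> r [hr /(Vc_eq _ hr)]; split=> //; apply/(Vc_eq _ hr); congruence.
(* The value is read off a chosen representative, with default [0] on sets that are not such a
   class; [classE] makes it independent of the choice. *)
pose f (X : set E) : K0 E := xget 0 [set u | exists p (hp : projection p),
  [/\ ~ B p, X = mvn_class p & u = K0_class hp]].
have fE (p : E) (hp : projection p) : ~ B p -> f (mvn_class p) = K0_class hp.
  move=> nBp; rewrite /f; case: xgetP => [u -> [q [hq [nBq /(classE _ _ hp hq) e ->]]]|].
    by rewrite /K0_class -[V_class _]/(Vc hq) -e.
  by move=> /(_ (K0_class hp))[]; exists p, hp.
exists f; split=> //; split.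
- by [].
- move=> _ _ /set_mem[p [hp nBp] <-] /set_mem[q [hq nBq] <-].
  rewrite (fE _ hp) // (fE _ hq) // => e; apply/(classE _ _ hp hq).
  apply: (groth_class_ideal_inj (Vnon_ex hpi pinf) (Vnon_add hB hpi pinf hPC)
    (Vnon_sub hB hpi pinf hPC)) e; [by exists p, hp|by exists q, hq].
- move=> u _; have [_ [p [hp [nBp ->]]] ->] := groth_class_ideal_surj (Vnon_ex hpi pinf)
    (Vnon_add hB hpi pinf hPC) (Vnon_sub hB hpi pinf hPC) u.
  by exists (mvn_class p); [exists p|rewrite (fE _ hp)].
Qed.
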